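(* Suppose that for each $n$ one has a random unit vector $u = u^{(n)} = (u_1,\ldots,u_n) \in \mathbb{R}^n$ such that (i) (Exchangeability) the distribution of $u$ is symmetric with respect to the permutation group $S_n$ (acting by permuting coordinates); (ii) for any distinct $i_1,\ldots,i_k$ with $k$ fixed, $\sqrt{n}\, u_{i_1},\ldots,\sqrt{n}\, u_{i_k}$ converges jointly in distribution to $k$ iid copies of $N(0,1)_{\mathbb{R}}$ as $n \to \infty$; (iii) (Symmetry) the distribution of $u$ is symmetric with respect to the reflection group $\{-1,+1\}^n$ (acting by changing the signs of coordinates). Then for any unit vector $a = a_n \in \mathbb{R}^n$ (depending on $n$), $\sqrt{n}\, a \cdot u$ converges in distribution to $N(0,1)_{\mathbb{R}}$ as $n\to\infty$.
   Context: $N(0,1)_{\mathbb{R}}$ denotes the standard real normal distribution (mean zero, variance one). $n$ is a parameter tending to infinity, and the random vector $u$ and the deterministic vector $a$ depend on $n$. *)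

(* Defs.v *)
From HB Require Import structures.
From mathcomp Require Import all_boot all_order all_algebra perm.
From mathcomp Require Import all_classical all_reals all_analysis.
Import Order.TTheory GRing.Theory Num.Theory.
Import numFieldNormedType.Exports.

Set Implicit Arguments.
Unset Strict Implicit.
Unset Printing Implicit Defensive.

Local Open Scope classical_set_scope.
Local Open Scope ring_scope.

(* R^n is the type 'rV[R]_n of row vectors, with the Borel sigma-algebra of its
   usual topology. *)
HB.instance Definition _ (R : realType) (m n : nat) :=
  @isMeasurable.Build (sigma_display (@open 'M[R]_(m, n))) 'M[R]_(m, n)
    <<s @open 'M[R]_(m, n) >>
    (@sigma_algebra0 _ setT (@open 'M[R]_(m, n)))
    (@sigma_algebraC _ (@open 'M[R]_(m, n)))
    (@sigma_algebra_bigcup _ setT (@open 'M[R]_(m, n))).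

Definition dotprod (R : realType) (n : nat) (x y : 'rV[R]_n) : R :=
  \sum_(i < n) x ord0 i * y ord0 i.

(* The norm `|x| of the library on 'rV[R]_n is the sup norm, not this one. *)
Definition l2norm (R : realType) (n : nat) (x : 'rV[R]_n) : R :=
  Num.sqrt (dotprod x x).

Definition flip_signs (R : realType) (n : nat) (e : 'I_n -> bool)
  (x : 'rV[R]_n) : 'rV[R]_n := \row_(i < n) ((-1) ^+ e i * x ord0 i).

(* The coordinate with index i : nat, so that a fixed i makes sense in every
   R^n; it is 0 by convention when n <= i, which for a given i concerns only
   finitely many n. *)
Definition coordinate (R : realType) (n : nat) (x : 'rV[R]_n) (i : nat) : R :=
  oapp (x ord0) 0 (insub i : option 'I_n).

Definition equal_in_law d d' (T : measurableType d) (V : measurableType d')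
  (R : realType) (P : probability T R) (X Y : T -> V) : Prop :=
  forall A : set V, measurable A -> pushforward P X A = pushforward P Y A.

(* E f(X_n) --> E f(Z) for all bounded continuous f; the X_n and Z need not
   live on the same probability space. *)
Definition cvg_in_distribution (R : realType) (V : topologicalType)
  (d : nat -> measure_display) (T : forall n, measurableType (d n))
  (P : forall n, probability (T n) R) (X : forall n, T n -> V)
  d' (S : measurableType d') (Q : probability S R) (Z : S -> V) : Prop :=
  forall f : V -> R, continuous f -> (exists M : R, forall x, `|f x| <= M) ->
    ('E_(P n)[f \o X n] @[n --> \oo] --> 'E_Q[f \o Z])%E.

Definition mutually_independent d (T : measurableType d) (R : realType)
  (P : probability T R) (I : finType) (X : I -> {RV P >-> R}) : Prop :=
  forall (J : {set I}) (A : I -> set R), (forall i, measurable (A i)) ->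
    P [set w | forall i, i \in J -> A i (X i w)] =
      (\prod_(i in J) P (X i @^-1` A i))%E.

Definition iid_std_normal d (T : measurableType d) (R : realType)
  (P : probability T R) (I : finType) (Z : I -> {RV P >-> R}) : Prop :=
  mutually_independent Z /\
  forall i (A : set R), measurable A ->
    distribution P (Z i) A = normal_prob 0 1 A.

(* Main.v *)
(* By sign symmetry, S = sqrt n (a . u) = sum_j a_j x_j with x_j = sqrt n u_j
   satisfies E cos(t S) = E prod_j cos(t a_j x_j).  The factors are replaced one
   at a time by exp(-t^2 a_j^2 / 2), starting with the smallest a_j: as long as
   m coordinates, a positive proportion of n, have already been removed, the
   cost of replacing the factor of index j is o(a_j^2), because exchangeability
   allows to average cos(s x_i) - exp(-s^2/2) over m coordinates i which do not
   occur in the other factors, and this average is o(s^2) in L^1 by a second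
   moment computation, which involves the joint law of two coordinates only.
   (E x_j^2 = 1 provides the uniform integrability needed to truncate x_j^2; a
   Taylor expansion of the cosine in s makes the estimate uniform in s.)  The
   first replacements cost at most t^2 a_j^2 each, and the smallest a_j^2 is at
   most 2/n.  Hence E cos(t S) --> exp(-t^2/2) for every t.

   For a bounded continuous test function f, sign symmetry reduces to f even;
   such an f is approximated on [-L, L] by a Bernstein polynomial in
   (1 + cos(pi x / L)) / 2, and E S^2 = 1 controls the error outside. *)
Require Import Defs.
From mathcomp Require Import all_boot all_order all_algebra perm.
From mathcomp Require Import all_classical all_reals all_analysis.
From mathcomp Require Import measurable_realfun.
From mathcomp Require Import ring lra zify.
Import Order.TTheory GRing.Theory Num.Theory.
Import numFieldNormedType.Exports.

Set Implicit Arguments.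
Unset Strict Implicit.
Unset Printing Implicit Defensive.

Local Open Scope classical_set_scope.
Local Open Scope ring_scope.

(** The vector [a] is arbitrary: its mass may sit on a few coordinates or be spread over all of
    them, so n factors have to be replaced with a total error o(1). An error o(1) per factor would
    be useless; an error o(a_j^2) suffices, since the a_j^2 sum to 1. The difficulty is that the
    remaining factors depend on x_j in an unknown way, and nothing is known on products of a growing
    number of coordinates. All that is retained of these factors is that their product W satisfies
    |W| <= 1 and does not change when coordinates that it does not involve are permuted; splitting
    cos(t S) by sign symmetry is what gives W this form. The order s^2 survives the averaging
    because the cosine is first replaced by a polynomial of fixed degree in a truncated square:
    after centring, the constant term vanishes and every other coefficient carries a factor s^2. *)

(** * Estimates on sine and cosine *)

Section trig.
Context {R : realType}.
Implicit Types x y z : R.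

Lemma ler_norm_sin x : `|sin x| <= `|x|.
Proof.
wlog x0 : x / 0 <= x => [h|].
  have [/h//|/ltW x0] := leP 0 x.
  by rewrite -normrN -sinN -(normrN x) h// oppr_ge0.
have [->|xn0] := eqVneq x 0; first by rewrite sin0.
have {x0 xn0} x0 : 0 < x by rewrite lt_neqAle eq_sym xn0.
have [c _] := @MVT R sin cos 0 x x0 (fun y _ => is_derive_sin y)
  (continuous_subspaceT (@continuous_sin R)).
by rewrite sin0 !subr0 => ->; rewrite normrM ler_piMl// cos_max.
Qed.

Lemma cosB_prod x y :
  cos x - cos y = - (2 * sin ((x + y) / 2) * sin ((x - y) / 2)).
Proof.
have -> : cos x = cos ((x + y) / 2 + (x - y) / 2) by congr cos; lra.
have -> : cos y = cos ((x + y) / 2 - (x - y) / 2) by congr cos; lra.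
rewrite cosD cosB; lra.
Qed.

(** The cosine is Lipschitz in the square of its argument: an error on y^2 becomes an error of order
    s^2 on cos (s y). *)
Lemma ler_dist_cos x y : `|cos x - cos y| <= `|x ^+ 2 - y ^+ 2| / 2.
Proof.
rewrite cosB_prod normrN !normrM ger0_norm//.
have h1 := ler_norm_sin ((x + y) / 2); have h2 := ler_norm_sin ((x - y) / 2).
have -> : `|x ^+ 2 - y ^+ 2| / 2 = 2 * `|(x + y) / 2| * `|(x - y) / 2|.
  have -> : x ^+ 2 - y ^+ 2 = 4 * (((x + y) / 2) * ((x - y) / 2)) by field.
  by rewrite !normrM (@ger0_norm _ 4)//; field.
by rewrite -!mulrA ler_wpM2l// ler_pM.
Qed.

(** In the variable z, cos (sqrt z) is an entire series. The error is relative to z, not merely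
    uniform: the constant terms agree and the rest is divisible by z. *)
Lemma cos_sqrt_taylor Y (e : R) : 0 <= Y -> 0 < e -> exists N : nat,
  forall z, 0 <= z <= Y ->
    `|cos (Num.sqrt z) - \sum_(k < N) (- z) ^+ k / (k.*2)`!%:R| <= e * z.
Proof.
move=> Y0 e0.
have cvgE : series (exp_coeff Y) @ \oo --> expR Y by exact: is_cvg_series_exp_coeff.
have ndE : nondecreasing_seq (series (exp_coeff Y)).
  by apply: nondecreasing_series => n _ _; rewrite exp_coeff_ge0.
have /cvgrPdist_le/(_ _ e0)[N0 _ HN0] := cvgE.
(* The shift by one: the term of index k + 1 of the cosine series is at most z times the term of
   index k of the series of [expR Y], as (2k+2)! >= k!. *)
exists N0.+1 => z /andP[z0 zY].
have cvgc : series (cos_coeff' (Num.sqrt z)) @ \oo --> cos (Num.sqrt z).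
  exact: cvg_cos_coeff'.
have coeffE k : cos_coeff' (Num.sqrt z) k = (- z) ^+ k / (k.*2)`!%:R.
  rewrite /cos_coeff' -mul2n exprM sqr_sqrtr// -exprnP.
  by rewrite [in RHS]exprNn.
have SE M : series (cos_coeff' (Num.sqrt z)) M =
    \sum_(k < M) (- z) ^+ k / (k.*2)`!%:R.
  by rewrite seriesEord/=; apply: eq_bigr => i _; rewrite coeffE.
have bnd M : (N0.+1 <= M)%N ->
    `|series (cos_coeff' (Num.sqrt z)) M - series (cos_coeff' (Num.sqrt z)) N0.+1|
      <= e * z.
  case: M => // M NM.
  rewrite sub_series_geq// (le_trans (ler_norm_sum _ _ _))//.
  rewrite big_add1/=.
  have : `|series (exp_coeff Y) M - series (exp_coeff Y) N0| <= e.
    rewrite ger0_norm ?subr_ge0; last exact: ndE.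
    have h1 : expR Y - series (exp_coeff Y) N0 <= e.
      exact: le_trans (ler_norm _) (HN0 N0 (leqnn _)).
    have h2 : series (exp_coeff Y) M <= expR Y.
      rewrite -(cvg_lim _ cvgE)//.
      by apply: (nondecreasing_cvgn_le ndE); exact: is_cvg_series_exp_coeff.
    by rewrite (le_trans _ h1)// lerD2r.
  rewrite sub_series_geq// => /(le_trans (ler_norm _)) h.
  rewrite [leRHS]mulrC; apply: le_trans (ler_wpM2l z0 h).
  rewrite mulr_sumr ler_sum// => k _.
  rewrite coeffE normrM normrX normrN (ger0_norm z0) exprS -mulrA ler_wpM2l//.
  rewrite /exp_coeff ger0_norm ?invr_ge0//.
  rewrite ler_pM ?invr_ge0 ?exprn_ge0//.
    by rewrite lerXn2r.
  by rewrite lef_pV2 ?posrE ?ltr0n ?fact_gt0// ler_nat leq_fact// -addnn (leq_trans (leqnSn _))// leq_addl.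
rewrite -SE.
have h : series (cos_coeff' (Num.sqrt z)) M -
   series (cos_coeff' (Num.sqrt z)) N0.+1 @[M --> \oo] -->
   cos (Num.sqrt z) - series (cos_coeff' (Num.sqrt z)) N0.+1.
  by apply: cvgB => //; exact: cvg_cst.
have /cvg_norm h' := h.
rewrite -(cvg_lim _ h')//; apply: limr_le; first by apply/cvg_ex; eexists; exact: h'.
by exists N0.+1 => // M /= NM; exact: bnd.
Qed.

End trig.

(** * Bernstein polynomials *)

Section bernstein.
Context {R : realType}.
Implicit Types (p x : R) (f g : nat -> R).

(* [bern N f p] is E f(B) for a binomial variable B of parameters N and p,
   computed by conditioning on the first trial. *)
Fixpoint bern (N : nat) (f : nat -> R) (p : R) : R :=
  if N is N'.+1 then p * bern N' (f \o S) p + (1 - p) * bern N' f p else f 0%N.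

Lemma bern_le N f g p : 0 <= p <= 1 ->
  (forall k, (k <= N)%N -> f k <= g k) -> bern N f p <= bern N g p.
Proof.
move=> /andP[p0 p1]; elim: N f g => [|N IH] f g fg /=; first exact: fg.
rewrite lerD// ler_wpM2l ?subr_ge0//; apply: IH => k kN; apply: fg => //.
by rewrite leqW.
Qed.

Lemma bernD N f g p : bern N (fun k => f k + g k) p = bern N f p + bern N g p.
Proof.
elim: N f g => //= N IH f g; rewrite IH.
rewrite (IH (f \o S) (g \o S)); ring.
Qed.

Lemma bernZ N f (c : R) p : bern N (fun k => c * f k) p = c * bern N f p.
Proof. elim: N f => //= N IH f; rewrite IH (IH (f \o S)); ring. Qed.

Lemma bern_cst N (c : R) p : bern N (fun=> c) p = c.
Proof. by elim: N => //= N IH; rewrite [X in p * X]IH IH; ring. Qed.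

(** Squared bias plus binomial variance. The centre x is arbitrary for the induction: a success at
    the first trial shifts it to x - 1. *)
Lemma bern_sqr N x p :
  bern N (fun k => (k%:R - x) ^+ 2) p = (N%:R * p - x) ^+ 2 + N%:R * p * (1 - p).
Proof.
elim: N x => [|N IH] x /=; first by rewrite !mul0r addr0.
rewrite IH.
have -> : bern N ((fun k => (k%:R - x) ^+ 2) \o S) p =
    bern N (fun k => (k%:R - (x - 1)) ^+ 2) p.
  by congr bern; apply/funext => k /=; rewrite -[in LHS]natr1; ring.
by rewrite IH -natr1; ring.
Qed.

(** Chebyshev's argument: [bern] is linear and monotone, so the quadratic bound can be averaged, and
    B/N has variance p(1 - p)/N <= 1/N. *)
Lemma bern_approx N f p (y e C : R) : (0 < N)%N -> 0 <= C -> 0 <= p <= 1 ->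
  (forall k, (k <= N)%N -> `|y - f k| <= e + C * (k%:R / N%:R - p) ^+ 2) ->
  `|y - bern N f p| <= e + C / N%:R.
Proof.
move=> N0 C0 p01 H.
have Np : 0 < N%:R :> R by rewrite ltr0n.
have ub : bern N (fun k => e + C * (k%:R / N%:R - p) ^+ 2) p <= e + C / N%:R.
  rewrite bernD bern_cst lerD2l.
  have -> : (fun k => C * (k%:R / N%:R - p) ^+ 2) =
      (fun k : nat => C / N%:R ^+ 2 * (k%:R - N%:R * p) ^+ 2).
    apply/funext => k; field; exact: lt0r_neq0.
  rewrite bernZ bern_sqr subrr expr0n/= add0r.
  have -> : C / N%:R ^+ 2 * (N%:R * p * (1 - p)) = C / N%:R * (p * (1 - p)).
    by field; exact: lt0r_neq0.
  by rewrite ler_piMr ?divr_ge0//; nra.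
rewrite ler_distl; apply/andP; split.
  have h : bern N f p <= bern N (fun k => y + (e + C * (k%:R / N%:R - p) ^+ 2)) p.
    by apply: bern_le => // k /H; rewrite ler_distl => /andP[]; lra.
  move: h; rewrite bernD bern_cst; lra.
have h : bern N (fun k => y + -1 * (e + C * (k%:R / N%:R - p) ^+ 2)) p <= bern N f p.
  by apply: bern_le => // k /H; rewrite ler_distl => /andP[]; lra.
move: h; rewrite bernD bern_cst bernZ; lra.
Qed.

End bernstein.

(** * Trigonometric approximation *)

Section cos_approximation.
Context {R : realType}.
Implicit Types (g : R -> R).

(** Only x is confined to K, while y may leave it; the radius is halved so that x' and y both stay
    in the ball where g is within e/2 of g x. *)
Lemma continuous_compact_unif g (K : set R) (e : R) : continuous g ->
  compact K -> 0 < e ->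
  exists2 del : R, 0 < del &
    forall x y, K x -> `|x - y| < del -> `|g x - g y| <= e.
Proof.
move=> cg /compact_near_coveringP cK e0.
have h : forall x : R, K x -> \forall x' \near x & i \near 0^'+,
    forall y : R, `|x' - y| < i -> `|g x' - g y| <= e.
  move=> x Kx.
  have e2 : 0 < e / 2 by rewrite divr_gt0.
  have /cvgrPdist_lt/(_ _ e2)/nbhs_ballP[d /= d0 Hd] := cg x.
  have d2 : 0 < d / 2 by rewrite divr_gt0.
  exists (ball x (d / 2), [set i | i < d / 2]) => /=.
    split; first exact: nbhsx_ballx.
    by apply: nbhs_right_lt.
  move=> [x' i] /= [xx' id] y x'y.
  have h1 := Hd x'; have h2 := Hd y.
  have {}h1 : `|g x - g x'| < e / 2.
    by apply: h1; rewrite /ball /= in xx' *; lra.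
  have {}h2 : `|g x - g y| < e / 2.
    apply: h2; rewrite /ball /= in xx' *.
    rewrite (le_lt_trans (ler_distD x' _ _))//; lra.
  by rewrite (le_trans (ler_distD (g x) _ _))// distrC; lra.
have := cK _ _ _ _ h; rewrite near_withinE.
move=> /(_ _)/nbhs_ballP[d /= d0 Hd].
exists (d / 2); first by rewrite divr_gt0.
move=> x y Kx xy; apply: (Hd (d / 2)) => //.
- by rewrite /ball /= sub0r normrN gtr0_norm ?divr_gt0//; lra.
- by rewrite divr_gt0.
Qed.

Lemma le_sin_mid (h z : R) : 0 <= h -> h <= z -> z <= pi - h -> sin h <= sin z.
Proof.
move=> h0 hz zh.
have pi0 := pi_gt0 R.
have mono (a b : R) : 0 <= a -> a <= b -> b <= pi / 2 -> sin a <= sin b.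
  move=> a0; rewrite le_eqVlt => /predU1P[->//|ab bp].
  by rewrite ltW// ltr_sin// in_itv/=; apply/andP; split; lra.
have [zp|/ltW zp] := leP z (pi / 2); first exact: mono.
have -> : sin z = sin (pi - z) by rewrite sinB sinpi cospi; ring.
apply: mono => //; lra.
Qed.

(** Quantitative injectivity of the cosine on [0, pi]: the half sum and the half difference both lie
    in [h, pi - h], where the sine is at least sin h. *)
Lemma cos_sep (h x y : R) : 0 < h -> 0 <= x <= pi -> 0 <= y <= pi ->
  h *+ 2 <= `|x - y| -> sin h ^+ 2 <= `|(cos x - cos y) / 2|.
Proof.
move=> h0; wlog xy : x y / y <= x => [H|].
  have [/H//|/ltW xy x0 y0] := leP y x.
  by rewrite distrC => hxy; rewrite -normrN -mulNr opprB H.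
move=> /andP[x0 xp] /andP[y0 yp]; rewrite ger0_norm ?subr_ge0// => hxy.
rewrite cosB_prod.
have s1 : sin h <= sin ((x + y) / 2) by apply: le_sin_mid; lra.
have s2 : sin h <= sin ((x - y) / 2) by apply: le_sin_mid; lra.
have sh : 0 <= sin h by apply: sin_ge0_pi; lra.
have -> : - (2 * sin ((x + y) / 2) * sin ((x - y) / 2)) / 2 =
  - (sin ((x + y) / 2) * sin ((x - y) / 2)) by field.
by rewrite normrN ger0_norm ?expr2 ?ler_pM// mulr_ge0//; lra.
Qed.

Definition cos_bern N (f : nat -> R) (t x : R) := bern N f ((1 + cos (t * x)) / 2).

Lemma half_cos01 (x : R) : 0 <= (1 + cos x) / 2 <= 1.
Proof. have := cos_geN1 x; have := cos_le1 x; lra. Qed.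

(** On [0, L], x is a function of p = (1 + cos (pi x / L)) / 2, so g can be read as a function of p,
    and evenness gives [-L, 0]. The bound by M holds on the whole line, by monotonicity of [bern];
    it is what controls the part outside [-L, L] later. *)
Lemma even_cos_approx g (M L e : R) : continuous g ->
  (forall x, g (- x) = g x) -> (forall x, `|g x| <= M) -> 0 < L -> 0 < e ->
  exists N f t, (forall x, `|x| <= L -> `|g x - cos_bern N f t x| <= e) /\
    (forall x, `|cos_bern N f t x| <= M).
Proof.
move=> cg geven gM L0 e0.
have pi0 := pi_gt0 R.
have M0 : 0 <= M by rewrite (le_trans _ (gM 0)).
have e2 : 0 < e / 2 by rewrite divr_gt0.
have [d d0 Hd] := continuous_compact_unif cg (@segment_compact R 0 L) e2.
pose t : R := pi / L.
have t0 : 0 < t by rewrite divr_gt0.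
(* Points at distance d become points at distance at least 2h after scaling by t; the cap pi/2
   ensures sin h > 0. *)
pose h := Num.min (t * d / 2) (pi / 2).
have h0 : 0 < h by rewrite lt_min !divr_gt0// mulr_gt0.
have hpi : h <= pi / 2 by rewrite ge_min lexx orbT.
have hd : h <= t * d / 2 by rewrite ge_min lexx.
have sh : 0 < sin h by apply: sin_gt0_pi; lra.
(* For points at distance at least d, [cos_sep] makes C (p y - p x)^2 at least 2M, which bounds any
   difference of values of g. *)
pose C := 2 * M / (sin h ^+ 2) ^+ 2.
have C0 : 0 <= C by rewrite divr_ge0 ?mulr_ge0 ?exprn_ge0// ltW.
pose p x : R := (1 + cos (t * x)) / 2.
have tpi x : 0 <= x <= L -> 0 <= t * x <= pi.
  move=> /andP[x0 xL]; rewrite mulr_ge0 ?(ltW t0)//= /t.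
  by rewrite mulrAC ler_pdivrMr// ler_wpM2l// ltW.
have gp x y : 0 <= x <= L -> 0 <= y <= L ->
    `|g x - g y| <= e / 2 + C * (p y - p x) ^+ 2.
  move=> xL yL; have [xyd|xyd] := ltP `|x - y| d.
    apply: le_trans (Hd _ _ _ xyd) _; first by rewrite /= in_itv.
    by rewrite lerDl mulr_ge0// sqr_ge0.
  have : sin h ^+ 2 <= `|p y - p x|.
    have -> : p y - p x = (cos (t * y) - cos (t * x)) / 2 by rewrite /p; field.
    apply: cos_sep => //; [exact: tpi|exact: tpi|].
    rewrite -mulrBr normrM (gtr0_norm t0) distrC -mulr_natr.
    have : t * d <= t * `|x - y| by rewrite ler_wpM2l// ltW.
    lra.
  move=> hp.
  have : C * (sin h ^+ 2) ^+ 2 <= C * (p y - p x) ^+ 2.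
    rewrite ler_wpM2l// -[leRHS]real_normK ?num_real//.
    by rewrite lerXn2r// ?nnegrE// exprn_ge0// ltW.
  rewrite /C divfK; last by rewrite expf_neq0// expf_neq0// gt_eqF.
  have := gM x; have := gM y; have := ler_normB (g x) (g y); lra.
pose N := (Num.truncn (2 * C / e)).+1.
have NC : 2 * C / e < N%:R by exact: truncnS_gt.
(* The point of [0, L] that p sends to the node k/N. *)
pose yk (k : nat) := acos (2 * k%:R / N%:R - 1) / t.
exists N, (g \o yk), t.
have N0 : 0 < N%:R :> R by rewrite ltr0n.
have argk k : (k <= N)%N -> -1 <= (2 * k%:R / N%:R - 1 : R) <= 1.
  move=> kN; have : 0 <= (k%:R / N%:R : R) <= 1.
    by rewrite divr_ge0//= ler_pdivrMr// mul1r ler_nat.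
  rewrite -mulrA; lra.
have yk0 k : (k <= N)%N -> 0 <= yk k <= L.
  move=> /argk ak; rewrite divr_ge0 ?acos_ge0 ?(ltW t0)//=.
  by rewrite ler_pdivrMr// /t mulrCA divff ?gt_eqF// mulr1 acos_lepi.
have pyk k : (k <= N)%N -> p (yk k) = k%:R / N%:R.
  move=> kN; rewrite /p /yk [t * _]mulrC divfK ?gt_eqF// acosK ?in_itv/= ?argk//.
  field; exact: lt0r_neq0.
have Tb x : `|cos_bern N (g \o yk) t x| <= M.
  rewrite ler_norml /cos_bern -[X in X <= _ <= _](bern_cst N _ ((1 + cos (t * x)) / 2)).
  rewrite -[X in _ <= _ <= X](bern_cst N _ ((1 + cos (t * x)) / 2)).
  by apply/andP; split; apply: bern_le => [|k _]; rewrite ?half_cos01//=;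
     have := gM (yk k); rewrite ler_norml => /andP[].
split=> // x.
wlog x0 : x / 0 <= x => [H|].
  have [/H//|/ltW x0 xL] := leP 0 x.
  rewrite -geven; have -> : cos_bern N (g \o yk) t x = cos_bern N (g \o yk) t (- x).
    by rewrite /cos_bern mulrN cosN.
  by apply: H; rewrite ?oppr_ge0 ?normrN.
rewrite ger0_norm// => xL.
have : `|g x - cos_bern N (g \o yk) t x| <= e / 2 + C / N%:R.
  apply: bern_approx => //; first exact: half_cos01.
  by move=> k kN; rewrite -pyk//; apply: gp; rewrite ?x0 ?xL ?yk0.
move=> /le_trans; apply.
have : C / N%:R <= e / 2.
  rewrite ler_pdivrMr//; move: NC; rewrite ltr_pdivrMr//; lra.
lra.
Qed.

End cos_approximation.

(** * The standard normal distribution *)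

Lemma bounded_integrable d (T : measurableType d) (R : realType)
    (P : probability T R) (f : T -> R) (M : R) :
  measurable_fun setT f -> (forall x, `|f x| <= M) ->
  P.-integrable setT (EFin \o f).
Proof.
move=> mf fM; apply: measurable_bounded_integrable => //.
  by rewrite [ltLHS](_ : _ = 1%E) ?ltry//; exact: probability_setT.
exists M; split=> [|x Mx y _]; first exact: num_real.
by rewrite /= (le_trans (fM y))// ltW.
Qed.

Lemma Rintegral_probability_cst d (T : measurableType d) (R : realType)
  (P : probability T R) (r : R) : \int[P]_x r = r.
Proof.
transitivity (r * fine (P setT)); first exact: Rintegral_cst.
by rewrite probability_setT mulr1.
Qed.

Section gaussian.
Context {R : realType}.
Local Notation mu := (@lebesgue_measure R).
Local Notation gamma := (normal_prob (0 : R) 1).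
Local Notation phi := (normal_pdf (0 : R) 1).

(** The Radon-Nikodym derivative satisfies this formula, and it agrees almost everywhere with [phi],
    both having the same integral over every measurable set. *)
Lemma ge0_integral_normal_prob (f : R -> \bar R) :
  measurable_fun setT f -> (forall x, 0 <= f x)%E ->
  (\int[gamma]_x f x = \int[mu]_x (f x * (phi x)%:E))%E.
Proof.
move=> mf f0; have dom := @normal_prob_dominates R 0 1.
rewrite -(Radon_Nikodym_SigmaFinite.change_of_variables dom)//.
have mphi : measurable_fun setT (EFin \o phi).
  by apply/measurable_EFinP; exact: measurable_normal_pdf.
have iRN := Radon_Nikodym_SigmaFinite.f_integrable dom.
apply: ae_eq_integral => //.
- by apply: emeasurable_funM => //; exact: measurable_int iRN.
- exact: emeasurable_funM.
- apply: ae_eqe_mul2l; apply: integral_ae_eq => //= E _ mE.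
  by rewrite -Radon_Nikodym_SigmaFinite.f_integral.
Qed.

Lemma phiE x : phi x = normal_peak 1 * expR (- (x ^+ 2 / 2)).
Proof.
rewrite normal_pdfE ?oner_neq0//; congr (_ * _).
by rewrite /normal_fun subr0 expr1n mulNr.
Qed.

Lemma phiN x : phi (- x) = phi x.
Proof. by rewrite !phiE sqrrN. Qed.

Lemma is_derive_phi (x : R) : is_derive x 1 phi (- x * phi x).
Proof.
have -> : phi = (fun x => normal_peak 1 * expR (- (x ^+ 2 / 2))).
  by apply/funext => y; rewrite phiE.
have h : is_derive x 1 (fun y : R => - (y ^+ 2 / 2)) (- x).
  apply: is_derive_eq.
  by rewrite /GRing.scale /=; field.
have h2 : is_derive x 1 (expR \o (fun y : R => - (y ^+ 2 / 2)))
   ((- x) * expR (- (x ^+ 2 / 2))).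
  apply: is_derive_eq.
  by rewrite /GRing.scale/=; field.
apply: is_derive_eq.
rewrite /GRing.scale/=; ring.
Qed.

Lemma integrable_sqr_phi : mu.-integrable setT (EFin \o (fun x => x ^+ 2 * phi x)).
Proof.
have s2 : Num.sqrt 2 != 0 :> R by rewrite gt_eqF// sqrtr_gt0.
(* Domination by the normal density of variance 2, which decays like exp(-x^2/4): the 4 comes from
   x^2/4 <= exp(x^2/4). *)
pose c : R := 4 * normal_peak 1 / normal_peak (Num.sqrt 2).
have := @integrable_normal_pdf R 0 (Num.sqrt 2).
move=> /(integrableZl measurableT c) ig.
apply: le_integrable ig => //.
  apply/measurable_EFinP; apply: measurable_funM; last exact: measurable_normal_pdf.
  exact: measurable_funX.
move=> x _ /=; rewrite lee_fin.
have p0 := @normal_peak_gt0 R _ s2.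
have p1 : 0 < normal_peak (1 : R) by rewrite normal_peak_gt0// oner_neq0.
rewrite phiE (normal_pdfE _ s2) /normal_fun subr0 sqr_sqrtr//.
rewrite ger0_norm; last first.
  by rewrite mulr_ge0 ?sqr_ge0// mulr_ge0 ?expR_ge0// ltW.
rewrite ger0_norm; last first.
  by rewrite /c !mulr_ge0 ?invr_ge0 ?expR_ge0// ltW.
have -> : c * (normal_peak (Num.sqrt 2) * expR (- x ^+ 2 / (2 *+ 2))) =
   4 * normal_peak 1 * expR (- (x ^+ 2 / 4)).
  rewrite /c -(mulr_natr 2 2) (_ : 2 * 2 = 4 :> R); last by ring.
  by rewrite mulNr; field; exact: lt0r_neq0.
have -> : - (x ^+ 2 / 2) = - (x ^+ 2 / 4) + - (x ^+ 2 / 4) by field.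
rewrite expRD.
set E := expR _.
have E0 : 0 < E by exact: expR_gt0.
suff : x ^+ 2 / 4 * E <= 1.
  move=> h.
  have -> : x ^+ 2 * (normal_peak 1 * (E * E)) =
     4 * normal_peak 1 * E * (x ^+ 2 / 4 * E) by field.
  by rewrite ler_piMr// !mulr_ge0 ?(ltW p1) ?(ltW E0).
rewrite /E expRN ler_pdivrMr ?expR_gt0// mul1r.
have := expR_ge1Dx (x ^+ 2 / 4); lra.
Qed.

Lemma cvg_integral_seg (f : R -> R) : mu.-integrable setT (EFin \o f) ->
  \int[mu]_(x in `[- n%:R, n%:R]) f x @[n --> \oo] --> \int[mu]_x f x.
Proof.
move=> intf; apply: fine_cvg.
rewrite fineK; last exact: integrable_fin_num.
have /measurable_EFinP mf := measurable_int _ intf.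
under eq_fun do rewrite integral_mkcond restrict_EFin.
apply: (@dominated_cvg _ _ _ mu setT measurableT
  (fun n x => ((f \_ `[- n%:R, n%:R]) x)%:E) _ (fun x => `|(f x)%:E|%E)) => //.
- move=> n; apply/measurable_EFinP.
  by apply/(measurable_restrictT f) => //; exact: measurable_funTS.
- move=> x _; apply: cvg_near_cst.
  exists (Num.truncn `|x|).+1 => // n /= xn.
  rewrite patchE mem_set//= in_itv/= -ler_norml.
  by rewrite (le_trans (ltW (truncnS_gt _)))// ler_nat.
- exact: integrable_abse.
- move=> n x _; rewrite lee_fin patchE; case: ifP => //.
  by rewrite normr0.
Qed.


Lemma continuous_phi : continuous phi.
Proof. by apply: continuous_normal_pdf; rewrite oner_neq0. Qed.

Lemma sqr_phi_le (x : R) : x ^+ 2 * phi x <= 2 * normal_peak 1.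
Proof.
rewrite phiE expRN mulrCA mulrC ler_wpM2r ?normal_peak_ge0//.
rewrite ler_pdivrMr ?expR_gt0//.
have := expR_ge1Dx (x ^+ 2 / 2); lra.
Qed.

(** The boundary term of the integration by parts is O(1/n): psi n is at most 2 A n, and n^2 phi n
    is bounded. *)
Lemma cvg_linear_growth_phi (psi : R -> R) (A : R) :
  (forall x, `|psi x| <= A * (1 + `|x|)) ->
  psi n%:R * phi n%:R @[n --> \oo] --> (0 : R).
Proof.
move=> psiA; apply: norm_cvg0.
have A0 : 0 <= A.
  by have := le_trans (normr_ge0 _) (psiA 0); rewrite normr0 addr0 mulr1.
pose c := A * 2 * (2 * normal_peak (1 : R)).
apply: (@squeeze_cvgr _ _ _ _ (cst 0) (fun n : nat => c * n%:R^-1)).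
- near=> n; rewrite normr_ge0/=.
  have n1 : 1 <= n%:R :> R.
    by rewrite -[1]/(1%:R) ler_nat; near: n; exact: nbhs_infty_ge.
  have n0 : 0 < n%:R :> R by rewrite (lt_le_trans _ n1).
  rewrite ler_pdivlMr// normrM (ger0_norm (normal_pdf_ge0 _ _ _)).
  have p0 := @normal_pdf_ge0 R 0 1 n%:R.
  apply: (@le_trans _ _ (A * 2 * (n%:R ^+ 2 * phi n%:R))); last first.
    by rewrite /c ler_wpM2l ?mulr_ge0// sqr_phi_le.
  have -> : A * 2 * (n%:R ^+ 2 * phi n%:R) = A * (2 * n%:R) * phi n%:R * n%:R by ring.
  rewrite !ler_wpM2r ?(ltW n0)//.
  apply: le_trans (psiA _) _; rewrite ler_wpM2l// ger0_norm ?(ltW n0)//; lra.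
- exact: cvg_cst.
- rewrite -[X in _ --> X](mulr0 c); apply: cvgM; first exact: cvg_cst.
  rewrite gtr0_cvgV0; first exact: cvgr_idn.
  by near=> n; rewrite /= ltr0n; near: n; exact: nbhs_infty_gt.
Unshelve. all: by end_near. Qed.

(* Integration by parts against the density, whose derivative is [- x * phi x]. *)
Lemma stein_identity (psi dpsi : R -> R) (A : R) :
  (forall x : R, is_derive x 1 psi (dpsi x)) -> continuous dpsi ->
  (forall x, psi (- x) = - psi x) ->
  (forall x, `|psi x| <= A * (1 + `|x|)) ->
  mu.-integrable setT (EFin \o (fun x => dpsi x * phi x)) ->
  mu.-integrable setT (EFin \o (fun x => x * psi x * phi x)) ->
  \int[mu]_x (x * psi x * phi x) = \int[mu]_x (dpsi x * phi x).
Proof.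
move=> dpsiE cdpsi psiN psiA int1 int2.
have cpsi : continuous psi.
  move=> x; apply: differentiable_continuous; apply/derivable1_diffP.
  by case: (dpsiE x).
pose f x := dpsi x * phi x - x * psi x * phi x.
have intf : mu.-integrable setT (EFin \o f).
  exact: (integrableB measurableT int1 int2).
have dF (x : R) : is_derive x 1 (psi \* phi) (f x).
  have h1 := dpsiE x; have h2 := is_derive_phi x.
  apply: is_derive_eq; rewrite /f /GRing.scale/=; ring.
have cF : continuous (psi \* phi).
  move=> x; apply: differentiable_continuous; apply/derivable1_diffP.
  by case: (dF x).
have cf : continuous f.
  move=> x; apply: cvgB; apply: cvgM.
  - exact: cdpsi.
  - exact: continuous_phi.
  - by apply: cvgM; [exact: cvg_id|exact: cpsi].
  - exact: continuous_phi.
(* Since psi is odd and phi is even, the two boundary terms add up to twice the one at n. *)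
have seg n : (0 < n)%N ->
    \int[mu]_(x in `[- n%:R, n%:R]) f x = 2 * (psi n%:R * phi n%:R).
  move=> n0; have nn : - n%:R < n%:R :> R by rewrite gtrN// ltr0n.
  rewrite /Rintegral (@continuous_FTC2 _ f (psi \* phi))//=.
  - by rewrite psiN phiN; ring.
  - exact: continuous_subspaceT.
  - split=> [x _| |].
    + by case: (dF x).
    + by apply: cvg_at_right_filter; exact: cF.
    + by apply: cvg_at_left_filter; exact: cF.
  - by move=> x _; rewrite derive1E; case: (dF x).
have lim0 : \int[mu]_(x in `[- n%:R, n%:R]) f x @[n --> \oo] --> (0 : R).
  have h : 2 * (psi n%:R * phi n%:R) @[n --> \oo] --> (0 : R).
    rewrite -[X in _ --> X](mulr0 2); apply: cvgM; first exact: cvg_cst.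
    exact: cvg_linear_growth_phi.
  apply: cvg_trans h; apply: near_eq_cvg.
  by exists 1%N => // n /= n0; rewrite seg.
have /eqP : \int[mu]_x f x = 0.
  exact: (cvg_unique _ (cvg_integral_seg intf) lim0).
by rewrite /f RintegralB// subr_eq0 => /eqP ->.
Qed.

Lemma integrable_bounded_phi (f : R -> R) (M : R) : measurable_fun setT f ->
  (forall x, `|f x| <= M) -> mu.-integrable setT (EFin \o (fun x => f x * phi x)).
Proof.
move=> mf fM; have ig := integrableZl measurableT M (@integrable_normal_pdf R 0 1).
apply: le_integrable ig => //.
  by apply/measurable_EFinP/measurable_funM => //; exact: measurable_normal_pdf.
move=> x _; rewrite lee_fin !normrM ler_wpM2r//.
by rewrite (le_trans (fM x))// ler_norm.
Qed.

Lemma Rintegral_phi : \int[mu]_x phi x = 1.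
Proof. by rewrite /Rintegral integral_normal_pdf. Qed.

Lemma measurable_cosM (t : R) : measurable_fun setT (fun x : R => cos (t * x)).
Proof.
apply: continuous_measurable_fun => x; apply: continuous_comp.
  by apply: cvgM; [exact: cvg_cst|exact: cvg_id].
exact: continuous_cos.
Qed.

Lemma measurable_sinM (t : R) : measurable_fun setT (fun x : R => sin (t * x)).
Proof.
apply: continuous_measurable_fun => x; apply: continuous_comp.
  by apply: cvgM; [exact: cvg_cst|exact: cvg_id].
exact: continuous_sin.
Qed.

Lemma integrable_id_phi : mu.-integrable setT (EFin \o (fun x => x * phi x)).
Proof.
have h1 := integrable_sqr_phi.
have h2 := @integrable_normal_pdf R 0 1.
apply: le_integrable (integrableD measurableT h1 h2) => //.
  by apply/measurable_EFinP/measurable_funM => //; exact: measurable_normal_pdf.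
move=> x _ /=; have p0 := @normal_pdf_ge0 R 0 1 x.
rewrite lee_fin normrM (ger0_norm p0) [leRHS]ger0_norm; last first.
  by rewrite addr_ge0// mulr_ge0// sqr_ge0.
rewrite -[X in _ + X]mul1r -mulrDl ler_wpM2r// ler_norml; nra.
Qed.

Lemma Rintegral_sqr_phi : \int[mu]_x (x ^+ 2 * phi x) = 1.
Proof.
transitivity (\int[mu]_x (1 * phi x)); last first.
  by under eq_Rintegral do rewrite mul1r; exact: Rintegral_phi.
apply: (@stein_identity id (cst 1) 1) => //.
- by move=> x; exact: cst_continuous.
- by move=> x; rewrite mul1r lerDr.
- by apply: (@integrable_bounded_phi (cst 1) 1) => // x; rewrite normr1.
- exact: integrable_sqr_phi.
Qed.

(** Differentiation under the integral, then [stein_identity] for sin (s x), give F' = - s F; hence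
    F(s) exp(s^2/2) is constant, equal to F(0) = 1. *)
Lemma Rintegral_cos_phi (t : R) : \int[mu]_x (cos (t * x) * phi x) = expR (- (t ^+ 2 / 2)).
Proof.
pose F t := \int[mu]_x (cos (t * x) * phi x).
pose f (t x : R) := cos (t * x) * phi x.
have intf (s : R) : mu.-integrable setT (EFin \o f s).
  by apply: (@integrable_bounded_phi _ 1) => [|x]; [exact: measurable_cosM|exact: cos_max].
have df (s x : R) : is_derive s 1 (f ^~ x) (- (x * sin (s * x) * phi x)).
  have h : is_derive s 1 (fun s : R => s * x) x.
    by apply: is_derive_eq; rewrite /GRing.scale/= mulr0 add0r mulr1.
  have h2 : is_derive s 1 (cos \o (fun s : R => s * x)) (x * - sin (s * x)).
    by apply: is_derive_eq; rewrite /GRing.scale/=; ring.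
  by apply: is_derive_eq; rewrite /GRing.scale/=; ring.
have p1 (s x : R) : partial1of2 f s x = - (x * sin (s * x) * phi x).
  by rewrite partial1of2E; case: (df s x).
have intx (s : R) : mu.-integrable setT (EFin \o (fun x => x * sin (s * x) * phi x)).
  apply: le_integrable integrable_id_phi => //.
    apply/measurable_EFinP/measurable_funM; last exact: measurable_normal_pdf.
    by apply: measurable_funM => //; exact: measurable_sinM.
  move=> x _; rewrite lee_fin !normrM ler_wpM2r//.
  by rewrite ler_piMr// sin_max.
have dF (s : R) : is_derive s 1 F (- s * F s).
  have intG : mu.-integrable setT (EFin \o (fun x => `|x * phi x|)).
    exact: integrable_norm integrable_id_phi.
  have Gub (x y : R) : `](s - 1), (s + 1)[%classic x -> setT y ->
      `|partial1of2 f x y| <= `|y * phi y|.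
    move=> _ _; rewrite p1 normrN !normrM ler_wpM2r//.
    by rewrite ler_piMr// sin_max.
  have sI : `](s - 1), (s + 1)[%classic s by rewrite /= in_itv/=; lra.
  have derf1 (x y : R) : `](s - 1), (s + 1)[%classic x -> setT y -> derivable (f ^~ y) x 1.
    by move=> _ _; case: (df x y).
  have intfI (x : R) : `](s - 1), (s + 1)[%classic x -> mu.-integrable setT (EFin \o f x).
    by [].
  apply: DeriveDef.
    exact: (derivable_under_integral measurableT sI intfI derf1 _ intG Gub).
  rewrite -derive1E.
  rewrite (differentiation_under_integral measurableT sI intfI derf1 _ intG Gub)//.
  under eq_Rintegral do rewrite p1 -mulN1r.
  rewrite RintegralZl//.
  have -> : \int[mu]_x (x * sin (s * x) * phi x) = \int[mu]_x (s * cos (s * x) * phi x).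
    apply: (@stein_identity (fun x => sin (s * x)) (fun x => s * cos (s * x)) 1).
    - move=> x; have h : is_derive x 1 (fun x : R => s * x) s.
        by apply: is_derive_eq; rewrite /GRing.scale/=; ring.
      have : is_derive x 1 (sin \o (fun x : R => s * x)) (s * cos (s * x)).
        by apply: is_derive_eq; rewrite /GRing.scale/=; ring.
      by [].
    - move=> x; apply: cvgM; first exact: cvg_cst.
      apply: continuous_comp; last exact: continuous_cos.
      by apply: cvgM; [exact: cvg_cst|exact: cvg_id].
    - by move=> x; rewrite mulrN sinN.
    - by move=> x; rewrite mul1r (le_trans (sin_max _))// lerDl.
    - apply: (@integrable_bounded_phi _ `|s|).
        by apply: measurable_funM => //; exact: measurable_cosM.
      by move=> x; rewrite normrM ler_piMr// cos_max.
    - exact: intx.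
  under eq_Rintegral do rewrite -mulrA.
  by rewrite RintegralZl//; [rewrite /F; ring|exact: intf].
pose G s := F s * expR (s ^+ 2 / 2).
have dG (s : R) : is_derive s 1 G 0.
  have h := dF s.
  have h1 : is_derive s 1 (fun s : R => s ^+ 2 / 2) s.
    by apply: is_derive_eq; rewrite /GRing.scale/=; field.
  have h2 : is_derive s 1 (expR \o (fun s : R => s ^+ 2 / 2))
      (s * expR (s ^+ 2 / 2)).
    by apply: is_derive_eq; rewrite /GRing.scale/=; ring.
  by apply: is_derive_eq; rewrite /GRing.scale/=; ring.
have : G t = 1.
  rewrite (is_derive_0_is_cst t 0 dG) /G expr0n/= mul0r expR0 mulr1 /F.
  under eq_Rintegral do rewrite mul0r cos0 mul1r.
  exact: Rintegral_phi.
have e0 : expR (t ^+ 2 / 2) != 0 by rewrite gt_eqF// expR_gt0.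
by rewrite /G -/(F t) expRN => h; apply: (mulIf e0); rewrite h mulVf.
Qed.

Lemma integrable_sqr_normal_prob : gamma.-integrable setT (EFin \o (fun x => x ^+ 2)).
Proof.
have mx : measurable_fun setT (EFin \o (fun x : R => x ^+ 2)).
  by apply/measurable_EFinP; exact: measurable_funX.
apply/integrableP; split=> //.
under eq_integral do rewrite /= ger0_norm ?sqr_ge0//.
rewrite ge0_integral_normal_prob//; last by move=> x; rewrite lee_fin sqr_ge0.
exact: integrable_lty integrable_sqr_phi.
Qed.

Lemma Rintegral_sqr_normal_prob : \int[gamma]_x (x ^+ 2) = 1.
Proof.
rewrite -[RHS]Rintegral_sqr_phi /Rintegral ge0_integral_normal_prob//.
  by apply/measurable_EFinP; exact: measurable_funX.
by move=> x; rewrite lee_fin sqr_ge0.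
Qed.

Lemma Rintegral_cos_normal_prob (t : R) :
  \int[gamma]_x cos (t * x) = expR (- (t ^+ 2 / 2)).
Proof.
have mc := measurable_cosM t.
have ic : gamma.-integrable setT (EFin \o (fun x => cos (t * x))).
  by apply: (@bounded_integrable _ _ _ _ _ 1) => // x; exact: cos_max.
have i1 : gamma.-integrable setT (EFin \o cst 1).
  exact: finite_measure_integrable_cst.
have icp : mu.-integrable setT (EFin \o (fun x => cos (t * x) * phi x)).
  by apply: (@integrable_bounded_phi _ 1) => // x; exact: cos_max.
(* Adding 1 makes the integrand nonnegative, as [ge0_integral_normal_prob] requires. *)
have : \int[gamma]_x (1 + cos (t * x)) = \int[mu]_x (phi x + cos (t * x) * phi x).
  rewrite /Rintegral ge0_integral_normal_prob//.
  - by congr fine; apply: eq_integral => x _; rewrite -EFinM mulrDl mul1r.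
  - by apply/measurable_EFinP; exact: measurable_funD.
rewrite RintegralD// RintegralD//; last exact: integrable_normal_pdf.
rewrite Rintegral_phi Rintegral_cos_phi Rintegral_probability_cst.
exact: addrI.
Qed.

End gaussian.

(** * Bounded random variables and random vectors *)

Section bounded_measurable.
Context d (T : measurableType d) (R : realType).
Implicit Types (f g : T -> R).

(** An algebra of functions integrable for every probability: most integrability side conditions
    below reduce to its closure properties. *)
Definition bounded_measurable f :=
  measurable_fun setT f /\ exists M : R, forall x, `|f x| <= M.

Lemma bounded_measurable_cst (c : R) : bounded_measurable (fun=> c).
Proof. by split=> //; exists `|c|. Qed.

Lemma bounded_measurableD f g : bounded_measurable f -> bounded_measurable g ->
  bounded_measurable (fun x => f x + g x).
Proof.
move=> [mf [M fM]] [mg [N gN]]; split; first exact: measurable_funD.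
by exists (M + N) => x; rewrite (le_trans (ler_normD _ _))// lerD.
Qed.

Lemma bounded_measurableM f g : bounded_measurable f -> bounded_measurable g ->
  bounded_measurable (fun x => f x * g x).
Proof.
move=> [mf [M fM]] [mg [N gN]]; split; first exact: measurable_funM.
by exists (M * N) => x; rewrite normrM ler_pM.
Qed.

Lemma bounded_measurableN f : bounded_measurable f ->
  bounded_measurable (fun x => - f x).
Proof.
move=> [mf [M fM]]; split; first exact: measurableT_comp.
by exists M => x; rewrite normrN.
Qed.

Lemma bounded_measurableB f g : bounded_measurable f -> bounded_measurable g ->
  bounded_measurable (fun x => f x - g x).
Proof.
by move=> bf bg; apply: bounded_measurableD => //; exact: bounded_measurableN.
Qed.

Lemma bounded_measurable_sum (I : Type) (r : seq I) (P : pred I) (F : I -> T -> R) :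
  (forall i, bounded_measurable (F i)) ->
  bounded_measurable (fun x => \sum_(i <- r | P i) F i x).
Proof.
move=> bF; elim: r => [|i r IH].
  by under eq_fun do rewrite big_nil; exact: bounded_measurable_cst.
under eq_fun do rewrite big_cons.
by case: (P i) => //; exact: bounded_measurableD.
Qed.

Lemma bounded_measurable_prod (I : Type) (r : seq I) (P : pred I) (F : I -> T -> R) :
  (forall i, bounded_measurable (F i)) ->
  bounded_measurable (fun x => \prod_(i <- r | P i) F i x).
Proof.
move=> bF; elim: r => [|i r IH].
  by under eq_fun do rewrite big_nil; exact: bounded_measurable_cst.
under eq_fun do rewrite big_cons.
by case: (P i) => //; exact: bounded_measurableM.
Qed.

Lemma bounded_measurable_comp (h : R -> R) f : continuous h ->
  (exists M, forall x, `|h x| <= M) -> measurable_fun setT f ->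
  bounded_measurable (h \o f).
Proof.
move=> ch [M hM] mf; split; last by exists M => x; exact: hM.
by apply: measurableT_comp => //; exact: continuous_measurable_fun.
Qed.

Lemma bounded_measurable_cos f : measurable_fun setT f ->
  bounded_measurable (fun x => cos (f x)).
Proof.
apply: bounded_measurable_comp; first exact: continuous_cos.
by exists 1; exact: cos_max.
Qed.

Context (P : probability T R).

Lemma bounded_measurable_integrable f : bounded_measurable f ->
  P.-integrable setT (EFin \o f).
Proof. by move=> [mf [M fM]]; exact: (@bounded_integrable _ _ _ _ _ M). Qed.

Lemma integrable_sumr (I : Type) (r : seq I) (Q : pred I) (F : I -> T -> R) :
  (forall i, P.-integrable setT (EFin \o F i)) ->
  P.-integrable setT (EFin \o (fun x => \sum_(i <- r | Q i) F i x)).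
Proof.
move=> iF; elim: r => [|i r IH].
  under eq_fun do rewrite big_nil.
  by apply: bounded_measurable_integrable; exact: bounded_measurable_cst.
under eq_fun do rewrite big_cons.
case: (Q i) => //; exact: (integrableD measurableT (iF i) IH).
Qed.

Lemma Rintegral_sum (I : Type) (r : seq I) (Q : pred I) (F : I -> T -> R) :
  (forall i, P.-integrable setT (EFin \o F i)) ->
  \int[P]_x (\sum_(i <- r | Q i) F i x) = \sum_(i <- r | Q i) \int[P]_x F i x.
Proof.
move=> iF; elim: r => [|i r IH].
  rewrite big_nil; under eq_Rintegral do rewrite big_nil.
  exact: Rintegral_probability_cst.
rewrite big_cons; under eq_Rintegral do rewrite big_cons.
case: (Q i) => //; rewrite RintegralD ?IH//; exact: integrable_sumr.
Qed.

End bounded_measurable.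

(** * Measurable maps on spaces of row vectors *)

Section row_vectors.
Context {R : realType}.

Lemma measurable_open_row n (A : set 'rV[R]_n) : open A -> measurable A.
Proof. by move=> oA; exact: sub_sigma_algebra. Qed.

Lemma continuous_row (U : topologicalType) n (f : U -> 'rV[R]_n) :
  (forall j, continuous (fun x => f x ord0 j)) -> continuous f.
Proof.
move=> cf x A [B nB BA]; apply: filterS BA _.
have : \forall y \near x, forall j : 'I_n, B ord0 j (f y ord0 j).
  apply: filter_forall => j; exact: cf (nB ord0 j).
apply: filterS => y By i j; rewrite (ord1 i); exact: By.
Qed.

Lemma continuous_measurable_row m n (f : 'rV[R]_m -> 'rV[R]_n) :
  continuous f -> measurable_fun setT f.
Proof.
move=> /continuousP cf; apply: (@measurability _ _ _ _ _ _ (@open 'rV[R]_n)) => //.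
move=> _ [A oA <-]; rewrite setTI; apply: measurable_open_row; exact: cf.
Qed.

Lemma measurable_coord n (j : 'I_n) :
  measurable_fun setT (fun v : 'rV[R]_n => v ord0 j).
Proof.
apply: (measurability _ (RGenOpens.measurableE R)).
move=> _ [_ [a [b ->] <-]]; rewrite setTI; apply: measurable_open_row.
have /continuousP := @coord_continuous R 1 n ord0 j.
by apply; exact: interval_open.
Qed.

Lemma measurable_col_perm n (s : 'S_n) :
  measurable_fun setT (col_perm s : 'rV[R]_n -> 'rV[R]_n).
Proof.
apply: continuous_measurable_row; apply: continuous_row => j.
under eq_fun do rewrite mxE.
exact: coord_continuous.
Qed.

Lemma measurable_flip_signs n (e : 'I_n -> bool) :
  measurable_fun setT (@flip_signs R n e).
Proof.
apply: continuous_measurable_row; apply: continuous_row => j.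
under eq_fun do rewrite mxE.
move=> x; apply: (@continuous_comp _ _ _ (fun v : 'rV[R]_n => v ord0 j)).
  exact: coord_continuous.
exact: mulrl_continuous.
Qed.

End row_vectors.

(** The positive and negative parts are each invariant by the formula for nonnegative functions, so
    f is only asked to be measurable. *)
Lemma Rintegral_invariant d (T : measurableType d) (R : realType)
    (mu : {measure set T -> \bar R}) (g : T -> T) (f : T -> R) :
  measurable_fun setT g ->
  (forall A, measurable A -> mu (g @^-1` A) = mu A) ->
  measurable_fun setT f -> \int[mu]_x f (g x) = \int[mu]_x f x.
Proof.
move=> mg gmu mf; congr fine.
have eqge0 (h : T -> \bar R) : measurable_fun setT h -> (forall x, 0 <= h x)%E ->
    (\int[mu]_x h (g x) = \int[mu]_x h x)%E.
  move=> mh h0.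
  rewrite -[LHS](@ge0_integral_pushforward _ _ _ _ _ g mg mu setT)//.
  by apply: eq_measure_integral => A mA _; exact: gmu.
have mf' : measurable_fun setT (EFin \o f) by exact/measurable_EFinP.
rewrite integralE [RHS]integralE; congr (_ - _)%E.
- rewrite -(eqge0 _ (measurable_funepos mf') (funepos_ge0 _)).
  by apply: eq_integral => x _; rewrite !funeposE.
- rewrite -(eqge0 _ (measurable_funeneg mf') (funeneg_ge0 _)).
  by apply: eq_integral => x _; rewrite !funenegE.
Qed.

(** * Exchangeable and sign-symmetric vectors *)

Section exchangeable_vectors.
Context {R : realType} (n : nat) (mu : probability 'rV[R]_n R).
Implicit Types (b : 'I_n -> R) (F : 'rV[R]_n -> R) (v : 'rV[R]_n).

Definition exchangeable := forall (s : 'S_n) (A : set 'rV[R]_n),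
  measurable A -> mu (col_perm s @^-1` A) = mu A.

Definition sign_symmetric := forall (e : 'I_n -> bool) (A : set 'rV[R]_n),
  measurable A -> mu (flip_signs e @^-1` A) = mu A.

Definition scaled_coord (j : 'I_n) v : R := Num.sqrt n%:R * v ord0 j.
Local Notation X := scaled_coord.

Lemma measurable_scaled_coord j : measurable_fun setT (X j).
Proof. by apply: measurable_funM => //; exact: measurable_coord. Qed.

Lemma scaled_coord_col_perm s j v : X j (col_perm s v) = X (s j) v.
Proof. by rewrite /scaled_coord mxE. Qed.

Lemma scaled_coord_flip_signs e j v : X j (flip_signs e v) = (-1) ^+ e j * X j v.
Proof. by rewrite /scaled_coord mxE mulrCA. Qed.

Lemma Rintegral_col_perm s F : exchangeable -> measurable_fun setT F ->
  \int[mu]_v F (col_perm s v) = \int[mu]_v F v.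
Proof.
move=> ex mF; apply: Rintegral_invariant => //; first exact: measurable_col_perm.
by move=> A; exact: ex.
Qed.

Lemma Rintegral_flip_signs e F : sign_symmetric -> measurable_fun setT F ->
  \int[mu]_v F (flip_signs e v) = \int[mu]_v F v.
Proof.
move=> ss mF; apply: Rintegral_invariant => //; first exact: measurable_flip_signs.
by move=> A; exact: ss.
Qed.

Lemma bounded_measurable_cosX (c : R) j :
  bounded_measurable (fun v => cos (c * X j v)).
Proof.
apply: bounded_measurable_cos.
by apply: measurable_funM => //; exact: measurable_scaled_coord.
Qed.

Lemma measurable_linear_comb b (Q : pred 'I_n) :
  measurable_fun setT (fun v => \sum_(j | Q j) b j * X j v).
Proof.
under eq_fun do rewrite big_mkcond; apply: measurable_sum => j.
case: (Q j) => //; apply: measurable_funM => //.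
exact: measurable_scaled_coord.
Qed.

(* Flipping the sign of one coordinate at a time and averaging turns
   cos (B + C) into cos B * cos C. *)
Lemma Rintegral_cos_linear_comb b : sign_symmetric ->
  \int[mu]_v cos (\sum_j b j * X j v) = \int[mu]_v \prod_j cos (b j * X j v).
Proof.
move=> ss.
(* After k flips the first k coordinates have moved to the product [W k]; the others are still in
   the sum [C k]. *)
pose W k v := \prod_(j < n | (j < k)%N) cos (b j * X j v).
pose C k v := \sum_(j < n | (k <= j)%N) b j * X j v.
suff H k : (k <= n)%N -> \int[mu]_v cos (\sum_j b j * X j v) =
    \int[mu]_v (W k v * cos (C k v)).
  rewrite (H n (leqnn n)); apply: eq_Rintegral => v _.
  have -> : C n v = 0 by rewrite /C big_pred0// => j; rewrite leqNgt ltn_ord.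
  rewrite cos0 mulr1.
  by rewrite /W; apply: eq_bigl => j; rewrite ltn_ord.
elim: k => [_|k IH kn].
  apply: eq_Rintegral => v _; have -> : W 0%N v = 1 by rewrite /W big_pred0.
  by rewrite mul1r.
rewrite IH 1?ltnW//.
pose o := Ordinal kn; pose B v := b o * X o v.
have CE v : C k v = B v + C k.+1 v.
  rewrite /C (bigD1 o) ?leqnn//=; congr (_ + _); apply: eq_bigl => j.
  by rewrite ltn_neqAle andbC -(inj_eq val_inj) eq_sym.
have WE v : W k.+1 v = W k v * cos (B v).
  rewrite /W (bigD1 o) ?leqnn//= mulrC; congr (_ * _); apply: eq_bigl => j.
  by rewrite [RHS]ltn_neqAle andbC -(inj_eq val_inj) ltnS.
pose e (j : 'I_n) := j == o.
have We v : W k (flip_signs e v) = W k v.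
  apply: eq_bigr => j jk; rewrite scaled_coord_flip_signs /e.
  by rewrite -(inj_eq val_inj)/= (ltn_eqF jk) expr0 mul1r.
have Ce v : C k.+1 (flip_signs e v) = C k.+1 v.
  apply: eq_bigr => j jk; rewrite scaled_coord_flip_signs /e.
  by rewrite -(inj_eq val_inj)/= (gtn_eqF jk) expr0 mul1r.
have Be v : B (flip_signs e v) = - B v.
  by rewrite /B scaled_coord_flip_signs /e eqxx expr1 mulN1r mulrN.
have bW m : bounded_measurable (W m).
  by apply: bounded_measurable_prod => j; exact: bounded_measurable_cosX.
have mB : measurable_fun setT B.
  by apply: measurable_funM => //; exact: measurable_scaled_coord.
have mC m : measurable_fun setT (C m) by exact: measurable_linear_comb.
have bp : bounded_measurable (fun v => W k v * cos (B v + C k.+1 v)).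
  apply: bounded_measurableM => //; apply: bounded_measurable_cos.
  exact: measurable_funD.
have bm : bounded_measurable (fun v => W k v * cos (- B v + C k.+1 v)).
  apply: bounded_measurableM => //; apply: bounded_measurable_cos.
  by apply: measurable_funD => //; exact: measurableT_comp.
under eq_Rintegral do rewrite CE.
have flipE : \int[mu]_v (W k v * cos (- B v + C k.+1 v)) =
    \int[mu]_v (W k v * cos (B v + C k.+1 v)).
  rewrite -(Rintegral_flip_signs e ss bp.1).
  by apply: eq_Rintegral => v _; rewrite We Ce Be.
have : \int[mu]_v (W k v * cos (B v + C k.+1 v) + W k v * cos (- B v + C k.+1 v)) =
    \int[mu]_v (2 * (W k.+1 v * cos (C k.+1 v))).
  apply: eq_Rintegral => v _; rewrite WE !cosD cosN sinN; ring.
rewrite RintegralD//; [|exact: bounded_measurable_integrable..].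
rewrite RintegralZl//; last first.
  apply: bounded_measurable_integrable; apply: bounded_measurableM => //.
  exact: bounded_measurable_cos.
rewrite flipE; lra.
Qed.

(** The n second moments are equal and add up to n times the squared norm, that is n. The
    computation is in extended reals because integrability is a consequence of it. *)
Lemma integral_scaled_coord_sqr j : exchangeable ->
  {ae mu, forall v, l2norm v = 1} -> (\int[mu]_v (X j v ^+ 2)%:E = 1)%E.
Proof.
move=> ex mu1.
have mX2 i : measurable_fun setT (fun v => (X i v ^+ 2)%:E).
  by apply/measurable_EFinP/measurable_funX; exact: measurable_scaled_coord.
have eqX i : (\int[mu]_v (X i v ^+ 2)%:E = \int[mu]_v (X j v ^+ 2)%:E)%E.
  have mp := @measurable_col_perm R n (tperm i j).
  transitivity (\int[mu]_v (X i (col_perm (tperm i j) v) ^+ 2)%:E)%E.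
    rewrite -[RHS](@ge0_integral_pushforward _ _ _ _ _ _ mp mu setT
      (fun v => (X i v ^+ 2)%:E))//.
      by apply: eq_measure_integral => A mA _; apply/esym; exact: ex.
    by move=> v _; rewrite lee_fin sqr_ge0.
  by apply: eq_integral => v _; rewrite scaled_coord_col_perm tpermL.
have n0 : (0 < n)%N by exact: leq_ltn_trans (ltn_ord j).
have nR : n%:R != 0 :> R by rewrite pnatr_eq0 -lt0n.
have : (\sum_(i < n) \int[mu]_v (X i v ^+ 2)%:E = n%:R%:E)%E.
  rewrite -ge0_integral_sum//; last by move=> i v _; rewrite lee_fin sqr_ge0.
  transitivity (\int[mu]_v (cst n%:R%:E v))%E; last first.
    transitivity (n%:R%:E * mu setT)%E; first exact: integral_cst.
    by rewrite probability_setT mule1.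
  apply: ae_eq_integral => //.
    exact: emeasurable_sum.
  apply: filterS mu1 => v v1 _.
  rewrite sumEFin /=; congr EFin.
  transitivity (n%:R * (l2norm v ^+ 2)); last by rewrite v1 expr1n mulr1.
  rewrite /l2norm sqr_sqrtr; last by apply: sumr_ge0 => i _; rewrite -expr2 sqr_ge0.
  rewrite /dotprod mulr_sumr; apply: eq_bigr => i _.
  by rewrite /scaled_coord exprMn sqr_sqrtr// expr2.
rewrite (eq_bigr _ (fun i _ => eqX i)) sumr_const card_ord => nH.
have H : (n%:R%:E * \int[mu]_v (X j v ^+ 2)%:E = n%:R%:E)%E.
  by rewrite mule_natl; exact: nH.
by rewrite -[LHS]mul1e -(mulVf nR) EFinM -muleA H -EFinM mulVf.
Qed.

Lemma integrable_scaled_coord_sqr j : exchangeable ->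
  {ae mu, forall v, l2norm v = 1} -> mu.-integrable setT (EFin \o (fun v => X j v ^+ 2)).
Proof.
move=> ex mu1; apply/integrableP; split.
  by apply/measurable_EFinP/measurable_funX; exact: measurable_scaled_coord.
under eq_integral do rewrite /= ger0_norm ?sqr_ge0//.
by rewrite integral_scaled_coord_sqr// ltry.
Qed.

Lemma Rintegral_scaled_coord_sqr j : exchangeable ->
  {ae mu, forall v, l2norm v = 1} -> \int[mu]_v (X j v ^+ 2) = 1.
Proof. by move=> ex mu1; rewrite /Rintegral integral_scaled_coord_sqr. Qed.

Lemma integrable_scaled_coordM i j : exchangeable ->
  {ae mu, forall v, l2norm v = 1} ->
  mu.-integrable setT (EFin \o (fun v => X i v * X j v)).
Proof.
move=> ex mu1; have h i := integrable_scaled_coord_sqr i ex mu1.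
apply: le_integrable (integrableD measurableT (h i) (h j)) => //.
  by apply/measurable_EFinP/measurable_funM; exact: measurable_scaled_coord.
move=> v _ /=; rewrite lee_fin normrM (@ger0_norm _ (_ + _)) ?addr_ge0 ?sqr_ge0//.
rewrite -(real_normK (num_real (X i v))) -(real_normK (num_real (X j v))).
have := sqr_ge0 (`|X i v| - `|X j v|); have := normr_ge0 (X i v).
have := normr_ge0 (X j v); nra.
Qed.

Lemma Rintegral_scaled_coordM i j : exchangeable -> sign_symmetric ->
  {ae mu, forall v, l2norm v = 1} -> \int[mu]_v (X i v * X j v) = (i == j)%:R.
Proof.
move=> ex ss mu1; have [->|ij] := eqVneq i j.
  exact: Rintegral_scaled_coord_sqr.
have mF : measurable_fun setT (fun v => X i v * X j v).
  by apply: measurable_funM; exact: measurable_scaled_coord.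
(* Flipping the sign of coordinate i alone changes the sign of the product, so its integral
   vanishes. *)
have := Rintegral_flip_signs (pred1 i) ss mF.
have -> : \int[mu]_v (X i (flip_signs (pred1 i) v) * X j (flip_signs (pred1 i) v)) =
    \int[mu]_v (-1 * (X i v * X j v)).
  apply: eq_Rintegral => v _; rewrite !scaled_coord_flip_signs /= eqxx.
  by rewrite [j == i]eq_sym (negbTE ij) /= expr1 expr0; ring.
rewrite RintegralZl//=; last exact: integrable_scaled_coordM.
by rewrite mulr0n; lra.
Qed.

Lemma linear_comb_sqrE b v : (\sum_j b j * X j v) ^+ 2 =
  \sum_i \sum_j (b i * b j) * (X i v * X j v).
Proof.
rewrite expr2 mulr_suml; apply: eq_bigr => i _; rewrite mulr_sumr.
by apply: eq_bigr => j _; rewrite mulrACA.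
Qed.

Lemma integrable_linear_comb_sqr b : exchangeable ->
  {ae mu, forall v, l2norm v = 1} ->
  mu.-integrable setT (EFin \o (fun v => (\sum_j b j * X j v) ^+ 2)).
Proof.
move=> ex mu1; under eq_fun do rewrite linear_comb_sqrE.
apply: integrable_sumr => i; apply: integrable_sumr => j.
exact: (integrableZl measurableT _ (integrable_scaled_coordM i j ex mu1)).
Qed.

Lemma Rintegral_linear_comb_sqr b : exchangeable -> sign_symmetric ->
  {ae mu, forall v, l2norm v = 1} ->
  \int[mu]_v ((\sum_j b j * X j v) ^+ 2) = \sum_j b j ^+ 2.
Proof.
move=> ex ss mu1; under eq_Rintegral do rewrite linear_comb_sqrE.
have ib i j : mu.-integrable setT (EFin \o (fun v => (b i * b j) * (X i v * X j v))).
  exact: (integrableZl measurableT _ (integrable_scaled_coordM i j ex mu1)).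
rewrite Rintegral_sum; last by move=> i; exact: integrable_sumr.
apply: eq_bigr => i _; rewrite Rintegral_sum// (bigD1 i)//= big1 ?addr0.
  by rewrite RintegralZl//; [rewrite Rintegral_scaled_coordM// eqxx mulr1|
    exact: integrable_scaled_coordM].
move=> j ji; rewrite RintegralZl//; last exact: integrable_scaled_coordM.
by rewrite Rintegral_scaled_coordM// eq_sym (negbTE ji) mulr0.
Qed.

(** First i1 goes to l', the preimage of l under the transposition of i0 and i, then this
    transposition is applied. The first move fixes i0 because l' differs from i0, that is, l differs
    from i. *)
Lemma exists_perm2 (i0 i1 i l : 'I_n) : i0 != i1 -> i != l ->
  exists s : 'S_n, s i0 = i /\ s i1 = l.
Proof.
move=> i01 il; pose l' := tperm i0 i l.
have l'0 : l' != i0.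
  by rewrite /l' -(inj_eq (@perm_inj _ (tperm i0 i))) tpermK tpermL eq_sym.
exists (tperm i1 l' * tperm i0 i)%g; rewrite !permM; split.
  by rewrite (tpermD _ l'0) 1?eq_sym// tpermL.
by rewrite tpermL /l' tpermK.
Qed.

(* Exchangeability allows to replace [h (X j)] by its average over all the
   coordinates on which the product does not depend. *)
Lemma Rintegral_prod_cos_average (J : {set 'I_n}) b j (h : R -> R) (B lam : R)
    (i0 i1 : 'I_n) :
  exchangeable -> j \notin J -> measurable_fun setT h -> (forall x, `|h x| <= B) ->
  0 < lam -> i0 != i1 ->
  `|\int[mu]_v ((\prod_(i in J) cos (b i * X i v)) * h (X j v))| <=
  lam / 2 + (B ^+ 2 / #|~: J|%:R + `|\int[mu]_v (h (X i0 v) * h (X i1 v))|) / (2 * lam).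
Proof.
move=> ex jJ mh hB lam0 i01.
pose W v := \prod_(i in J) cos (b i * X i v).
pose m := #|~: J|.
have jJC : j \in ~: J by rewrite inE.
have m0 : (0 < m)%N by apply/card_gt0P; exists j.
have mR : 0 < m%:R :> R by rewrite ltr0n.
have bh i : bounded_measurable (fun v => h (X i v)).
  split; last by exists B => v; exact: hB.
  by apply: measurableT_comp => //; exact: measurable_scaled_coord.
have bW : bounded_measurable W.
  by apply: bounded_measurable_prod => i; exact: bounded_measurable_cosX.
(* The transposition of i and j moves no index of J, so it leaves W unchanged. *)
have swap i : i \in ~: J -> \int[mu]_v (W v * h (X i v)) = \int[mu]_v (W v * h (X j v)).
  move=> iJ.
  rewrite -(@Rintegral_col_perm (tperm i j) (fun v => W v * h (X j v)))//; last first.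
    by case: (bounded_measurableM bW (bh j)).
  apply: eq_Rintegral => v _; rewrite scaled_coord_col_perm tpermR; congr (_ * _).
  apply: eq_bigr => k kJ; rewrite scaled_coord_col_perm tpermD//.
    by apply: contraTneq kJ => <-; move: iJ; rewrite inE.
  by apply: contraTneq kJ => <-.
pose A v := m%:R^-1 * \sum_(i in ~: J) h (X i v).
have bS : bounded_measurable (fun v => \sum_(i in ~: J) h (X i v)).
  exact: bounded_measurable_sum.
have bA : bounded_measurable A.
  by apply: bounded_measurableM => //; exact: bounded_measurable_cst.
have -> : \int[mu]_v (W v * h (X j v)) = \int[mu]_v (W v * A v).
  transitivity (m%:R^-1 * \sum_(i in ~: J) \int[mu]_v (W v * h (X i v))).
    have -> : \sum_(i in ~: J) \int[mu]_v (W v * h (X i v)) =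
        m%:R * \int[mu]_v (W v * h (X j v)).
      by rewrite (eq_bigr _ swap) sumr_const mulr_natl.
    by rewrite mulKf// gt_eqF.
  rewrite -Rintegral_sum; last first.
    by move=> i; apply: bounded_measurable_integrable; exact: bounded_measurableM.
  rewrite -RintegralZl//; last first.
    apply: bounded_measurable_integrable; apply: bounded_measurable_sum => i.
    exact: bounded_measurableM.
  by apply: eq_Rintegral => v _; rewrite /A -mulr_sumr mulrCA.
set c := `|\int[mu]_v (h (X i0 v) * h (X i1 v))|.
have bA2 : bounded_measurable (fun v => A v ^+ 2) by exact: bounded_measurableM.
(* Of the m^2 products, the m diagonal ones are at most B^2; by exchangeability all others have the
   integral of the pair (i0, i1). *)
have EA2 : \int[mu]_v (A v ^+ 2) <= B ^+ 2 / m%:R + c.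
  have -> : \int[mu]_v (A v ^+ 2) = m%:R ^- 2 *
      \sum_(i in ~: J) \sum_(l in ~: J) \int[mu]_v (h (X i v) * h (X l v)).
    under [in RHS]eq_bigr => i _.
      rewrite -Rintegral_sum; last first.
        by move=> l; apply: bounded_measurable_integrable; exact: bounded_measurableM.
      over.
    rewrite -Rintegral_sum; last first.
      move=> i; apply: bounded_measurable_integrable.
      by apply: bounded_measurable_sum => l; exact: bounded_measurableM.
    rewrite -RintegralZl//; last first.
      apply: bounded_measurable_integrable; apply: bounded_measurable_sum => i.
      by apply: bounded_measurable_sum => l; exact: bounded_measurableM.
    apply: eq_Rintegral => v _; rewrite /A exprMn exprVn; congr (_ * _).
    by rewrite expr2 mulr_suml; apply: eq_bigr => i _; rewrite mulr_sumr.
  have row i : i \in ~: J ->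
      \sum_(l in ~: J) \int[mu]_v (h (X i v) * h (X l v)) <= B ^+ 2 + m%:R * c.
    move=> iJ; rewrite (bigD1 i)//= lerD//.
      rewrite -[leRHS](Rintegral_probability_cst mu).
      apply: le_Rintegral => //.
      - by apply: bounded_measurable_integrable; exact: bounded_measurableM.
      - by apply: bounded_measurable_integrable; exact: bounded_measurable_cst.
      - move=> v _; rewrite -expr2 -real_normK ?num_real// lerXn2r ?nnegrE//.
        exact: le_trans (hB 0).
    apply: (@le_trans _ _ (\sum_(l in ~: J | l != i) c)).
      apply: ler_sum => l /andP[_ li]; rewrite eq_sym in li.
      have [s [<- <-]] := exists_perm2 i01 li.
      have := @Rintegral_col_perm s (fun v => h (X i0 v) * h (X i1 v)) ex
        (bounded_measurableM (bh i0) (bh i1)).1.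
      under eq_Rintegral do rewrite !scaled_coord_col_perm.
      by move=> ->; exact: ler_norm.
    rewrite big_mkcondr/= mulr_natl -sumr_const.
    apply: ler_sum => l _; case: ifP => // _; exact: normr_ge0.
  have -> : B ^+ 2 / m%:R + c = m%:R ^- 2 * (m%:R * (B ^+ 2 + m%:R * c)).
    field; exact: lt0r_neq0.
  rewrite ler_wpM2l ?invr_ge0 ?exprn_ge0//.
  rewrite mulr_natl -sumr_const; exact: ler_sum.
rewrite (le_trans (le_normr_Rintegral _ _))//.
  by apply: bounded_measurable_integrable; exact: bounded_measurableM.
(* With |W| <= 1, the inequality |A| <= lam/2 + A^2/(2 lam) plays the part of Cauchy-Schwarz. *)
apply: (@le_trans _ _ (\int[mu]_v (lam / 2 + (2 * lam)^-1 * A v ^+ 2))).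
  apply: le_Rintegral => //.
  - apply: bounded_measurable_integrable.
    have [mWA [M hM]] := bounded_measurableM bW bA.
    by split; [exact: measurableT_comp|exists M => v; rewrite normr_id].
  - apply: bounded_measurable_integrable; apply: bounded_measurableD.
      exact: bounded_measurable_cst.
    by apply: bounded_measurableM => //; exact: bounded_measurable_cst.
  - move=> v _; rewrite normrM.
    have W1 : `|W v| <= 1.
      by rewrite normr_prod prodr_ile1// => i _; rewrite normr_ge0 cos_max.
    apply: (@le_trans _ _ `|A v|); first by rewrite ler_piMl.
    rewrite -(real_normK (num_real (A v))).
    have -> : lam / 2 + (2 * lam)^-1 * `|A v| ^+ 2 =
        `|A v| + (2 * lam)^-1 * (`|A v| - lam) ^+ 2.
      field; exact: lt0r_neq0.
    by rewrite lerDl mulr_ge0 ?sqr_ge0// invr_ge0 mulr_ge0// ltW.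
rewrite RintegralD//.
- rewrite Rintegral_probability_cst lerD2l RintegralZl//; last first.
    exact: bounded_measurable_integrable.
  by rewrite mulrC ler_wpM2r// invr_ge0 mulr_ge0// ltW.
- by apply: bounded_measurable_integrable; exact: bounded_measurable_cst.
- apply: bounded_measurable_integrable; apply: bounded_measurableM => //.
  exact: bounded_measurable_cst.
Qed.

End exchangeable_vectors.

(** * Telescoping from cosines to Gaussian factors *)

Section telescoping.
Context {R : realType} (n : nat) (mu : probability 'rV[R]_n R).
Context (ex : exchangeable mu).
Context (mu1 : {ae mu, forall v, l2norm v = 1}).
Implicit Types (J : {set 'I_n}) (v : 'rV[R]_n).
Local Notation X := scaled_coord.
Local Notation cf s := (expR (- (s ^+ 2 / 2))).

Lemma cf_le1 (s : R) : cf s <= 1.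
Proof. by rewrite -expR0 ler_expR oppr_le0 divr_ge0// sqr_ge0. Qed.

Lemma bounded_measurable_prod_cos J (b : 'I_n -> R) :
  bounded_measurable (fun v => \prod_(i in J) cos (b i * X i v)).
Proof. by apply: bounded_measurable_prod => i; exact: bounded_measurable_cosX. Qed.

Lemma norm_prod_cos_le1 J (b : 'I_n -> R) v :
  `|\prod_(i in J) cos (b i * X i v)| <= 1.
Proof. by rewrite normr_prod prodr_ile1// => i _; rewrite normr_ge0 cos_max. Qed.

(** The crude cost, for the first replacements: cos (s x) and exp(-s^2/2) are within s^2 x^2/2 and
    s^2/2 of 1, and E x^2 = 1. *)
Lemma Rintegral_prod_cos_diff_le J (b : 'I_n -> R) j (s : R) :
  `|\int[mu]_v ((\prod_(i in J) cos (b i * X i v)) * (cos (s * X j v) - cf s))|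
    <= s ^+ 2.
Proof.
have iX := integrable_scaled_coord_sqr j ex mu1.
have bW := bounded_measurable_prod_cos J b.
have bWc : bounded_measurable
    (fun v => (\prod_(i in J) cos (b i * X i v)) * (cos (s * X j v) - cf s)).
  apply: bounded_measurableM => //; apply: bounded_measurableB.
    exact: bounded_measurable_cosX.
  exact: bounded_measurable_cst.
have icst : mu.-integrable setT (EFin \o (fun=> s ^+ 2 / 2)).
  by apply: bounded_measurable_integrable; exact: bounded_measurable_cst.
have iZ : mu.-integrable setT (EFin \o (fun v => s ^+ 2 / 2 * X j v ^+ 2)).
  exact: (integrableZl measurableT _ iX).
have iB := bounded_measurable_integrable mu bWc.
rewrite (le_trans (le_normr_Rintegral _ _))//.
apply: (@le_trans _ _ (\int[mu]_v (s ^+ 2 / 2 + s ^+ 2 / 2 * X j v ^+ 2))).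
  apply: le_Rintegral => //; [exact: integrable_norm|exact: (integrableD measurableT icst iZ)|].
  move=> v _; rewrite normrM (@le_trans _ _ `|cos (s * X j v) - cf s|)//.
    by rewrite ler_piMl// norm_prod_cos_le1.
  have h1 : `|cos (s * X j v) - cos 0| <= s ^+ 2 / 2 * X j v ^+ 2.
    rewrite (le_trans (ler_dist_cos _ _))// expr0n subr0 ger0_norm ?sqr_ge0//.
    by rewrite exprMn mulrAC.
  have h2 : `|cos 0 - cf s| <= s ^+ 2 / 2.
    rewrite cos0 ger0_norm ?subr_ge0 ?cf_le1//.
    have := expR_ge1Dx (- (s ^+ 2 / 2)); lra.
  by rewrite (le_trans (ler_distD (cos 0) _ _))// addrC lerD.
rewrite RintegralD// Rintegral_probability_cst RintegralZl//.
by rewrite Rintegral_scaled_coord_sqr// mulr1; lra.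
Qed.

Context (a : 'I_n -> R) (t : R).
Context (a1 : \sum_j a j ^+ 2 = 1).

(** J is the set of indices not yet replaced: the full set gives E cos(t S) in product form, the
    empty set gives exp(-t^2/2). *)
Definition hybrid J : R :=
  \int[mu]_v (\prod_(i in J) cos (t * a i * X i v)) *
  \prod_(i | i \notin J) cf (t * a i).

(** The Gaussian factors already in place are common to both terms and at most 1. *)
Lemma hybrid_step J j : j \notin J ->
  `|hybrid (j |: J) - hybrid J| <=
  `|\int[mu]_v ((\prod_(i in J) cos (t * a i * X i v)) *
     (cos (t * a j * X j v) - cf (t * a j)))|.
Proof.
move=> jJ; pose Q := \prod_(i | i \notin j |: J) cf (t * a i).
pose W v := \prod_(i in J) cos (t * a i * X i v).
have bW : bounded_measurable W by exact: bounded_measurable_prod_cos.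
have bWc : bounded_measurable (fun v => W v * cos (t * a j * X j v)).
  by apply: bounded_measurableM => //; exact: bounded_measurable_cosX.
have -> : hybrid (j |: J) - hybrid J =
    \int[mu]_v (W v * (cos (t * a j * X j v) - cf (t * a j))) * Q.
  rewrite /hybrid (bigD1 (P := fun i => i \notin J) j)//=.
  have -> : \prod_(i | (i \notin J) && (i != j)) cf (t * a i) = Q.
    by apply: eq_bigl => i; rewrite !inE negb_or andbC.
  have -> : \int[mu]_v (\prod_(i in j |: J) cos (t * a i * X i v)) =
      \int[mu]_v (W v * cos (t * a j * X j v)).
    by apply: eq_Rintegral => v _; rewrite big_setU1//= mulrC.
  have -> : \int[mu]_v (W v * (cos (t * a j * X j v) - cf (t * a j))) =
    \int[mu]_v (W v * cos (t * a j * X j v) - cf (t * a j) * W v).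
    by apply: eq_Rintegral => v _; rewrite mulrBr [cf _ * _]mulrC.
  rewrite RintegralB//; last 2 first.
  - exact: bounded_measurable_integrable.
  - apply: bounded_measurable_integrable; apply: bounded_measurableM => //.
    exact: bounded_measurable_cst.
  rewrite RintegralZl//; last exact: bounded_measurable_integrable.
  rewrite -[\prod_(i | i \notin j |: J) _]/Q; rewrite -/W; ring.
rewrite normrM ler_piMr// normr_prod prodr_ile1// => i _.
by rewrite normr_ge0 ger0_norm ?expR_ge0// cf_le1.
Qed.

(** The complement only grows while J is emptied, so the bound for m free coordinates applies to
    each removal; the order of the removals is arbitrary. *)
Lemma hybrid_small (m : nat) (del : R) J :
  (forall J' j, j \notin J' -> (m <= #|~: J'|)%N ->
    `|\int[mu]_v ((\prod_(i in J') cos (t * a i * X i v)) *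
       (cos (t * a j * X j v) - cf (t * a j)))| <= del * (t * a j) ^+ 2) ->
  (m <= #|~: J|)%N ->
  `|hybrid J - hybrid finset.set0| <= del * t ^+ 2 * \sum_(j in J) a j ^+ 2.
Proof.
move=> H; move: {2}#|J| (erefl #|J|) => k.
elim: k J => [|k IH] J Jk mJ.
  by rewrite (cards0_eq Jk) subrr normr0 big_set0 mulr0.
have [j jJ] : exists j, j \in J by apply/card_gt0P; rewrite Jk.
pose J' := J :\ j.
have JE : J = j |: J' by rewrite finset.setD1K.
have jJ' : j \notin J' by rewrite !inE eqxx.
have J'k : #|J'| = k by move: Jk; rewrite (cardsD1 j) jJ => -[].
have mJ' : (m <= #|~: J'|)%N.
  by apply: leq_trans mJ _; apply: subset_leq_card; rewrite finset.setCS finset.subD1set.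
rewrite JE (le_trans (ler_distD (hybrid J') _ _))//.
rewrite big_setU1//= mulrDr lerD ?IH//.
rewrite (le_trans (hybrid_step jJ'))// (le_trans (H _ _ jJ' mJ'))//.
by rewrite exprMn mulrA.
Qed.

(** Greedy removal of an index of J with the smallest a_j^2, each at the crude cost t^2 a_j^2. *)
Lemma hybrid_large (k : nat) : (k.*2 <= n)%N -> exists J, #|~: J| = k /\
  `|hybrid finset.setT - hybrid J| <= t ^+ 2 * (2 * k%:R / n%:R).
Proof.
elim: k => [_|k IH kn].
  by exists finset.setT; rewrite finset.setCT cards0 subrr normr0 !(mulr0, mul0r).
have {IH} [|J [Jk HJ]] := IH; first by rewrite (leq_trans _ kn)// leq_double.
have n0 : (0 < n)%N by rewrite (leq_trans _ kn).
have nR : 0 < n%:R :> R by rewrite ltr0n.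
have cJ : (#|J| + k = n)%N by rewrite -Jk cardsC card_ord.
(* At least half of the indices remain, so the least a_j^2 on J is at most 1/|J| <= 2/n. *)
have nJ : n%:R <= 2 * #|J|%:R :> R.
  by rewrite -natrM ler_nat; lia.
have J0 : (0 < #|J|)%N by lia.
have [j0 j0J] : exists j, j \in J by exact/card_gt0P.
pose j := [arg min_(j < j0 in J) (a j ^+ 2)]%O.
have [jJ jmin] : j \in J /\ forall i, i \in J -> a j ^+ 2 <= a i ^+ 2.
  by rewrite /j; case: arg_minP => // i iJ H; split.
have aj : a j ^+ 2 <= 2 / n%:R.
  have h : #|J|%:R * a j ^+ 2 <= 1.
    rewrite mulr_natl -sumr_const -a1 [leRHS](bigID (mem J))/=.
    rewrite -[leLHS]addr0 lerD ?ler_sum ?sumr_ge0// => i _; exact: sqr_ge0.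
  rewrite ler_pdivlMr// mulrC.
  have := sqr_ge0 (a j); nra.
exists (J :\ j); split.
  have := cardsC (J :\ j); rewrite card_ord; move: cJ; rewrite (cardsD1 j J) jJ; lia.
rewrite (le_trans (ler_distD (hybrid J) _ _))//.
have -> : t ^+ 2 * (2 * k.+1%:R / n%:R) =
    t ^+ 2 * (2 * k%:R / n%:R) + t ^+ 2 * (2 / n%:R).
  by rewrite -natr1; ring.
rewrite lerD//; have jJ' : j \notin J :\ j by rewrite !inE eqxx.
have {1}-> : J = j |: (J :\ j) by rewrite finset.setD1K.
rewrite (le_trans (hybrid_step jJ'))// (le_trans (Rintegral_prod_cos_diff_le _ _ _ _))//.
by rewrite exprMn ler_wpM2l// sqr_ge0.
Qed.

(** The threshold m is a compromise: m/n has to be small for the crude replacements, but m large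
    enough for the averaged ones to cost only del. *)
Lemma Rintegral_prod_cos_close (m : nat) (del : R) :
  (m.*2 <= n)%N -> 0 <= del ->
  (forall J' j, j \notin J' -> (m <= #|~: J'|)%N ->
    `|\int[mu]_v ((\prod_(i in J') cos (t * a i * X i v)) *
       (cos (t * a j * X j v) - cf (t * a j)))| <= del * (t * a j) ^+ 2) ->
  `|\int[mu]_v (\prod_i cos (t * a i * X i v)) - cf t| <=
     t ^+ 2 * (2 * m%:R / n%:R + del).
Proof.
move=> mn del0 H; have [J [Jm HJ]] := hybrid_large mn.
have -> : \int[mu]_v (\prod_i cos (t * a i * X i v)) = hybrid finset.setT.
  rewrite /hybrid big_pred0 ?mulr1; last by move=> i; rewrite inE.
  by apply: eq_Rintegral => v _; apply: eq_bigl => i; rewrite inE.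
have <- : hybrid finset.set0 = cf t.
  rewrite /hybrid; under eq_Rintegral do rewrite big_set0.
  rewrite Rintegral_probability_cst mul1r (eq_bigl xpredT); last first.
    by move=> i; rewrite inE.
  rewrite -expR_sum; congr expR.
  rewrite sumrN; congr (- _); under eq_bigr do rewrite exprMn mulrAC.
  by rewrite -mulr_sumr a1 mulr1.
rewrite (le_trans (ler_distD (hybrid J) _ _))// mulrDr lerD//.
have := hybrid_small H; move=> /(_ J); rewrite Jm => /(_ (leqnn _)) /le_trans; apply.
rewrite [leRHS]mulrC ler_piMr//; first by rewrite mulr_ge0// sqr_ge0.
rewrite -a1 [leRHS](bigID (mem J))/= lerDl sumr_ge0// => i _; exact: sqr_ge0.
Qed.

End telescoping.

(** * Asymptotics of the replacement step *)

Section truncated_square.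
Context {R : realType}.
Local Notation gamma := (normal_prob (0 : R) 1).

(** A bounded continuous substitute for the square, so that its powers are test functions for
    convergence in distribution. *)
Definition trunc_sqr (K y : R) : R := Num.min (y ^+ 2) K.

Lemma trunc_sqr_le K y : trunc_sqr K y <= y ^+ 2.
Proof. by rewrite ge_min lexx. Qed.

Lemma trunc_sqr_leK K y : trunc_sqr K y <= K.
Proof. by rewrite ge_min lexx orbT. Qed.

Lemma trunc_sqr_ge0 K y : 0 <= K -> 0 <= trunc_sqr K y.
Proof. by move=> K0; rewrite le_min sqr_ge0. Qed.

Lemma continuous_trunc_sqr K : continuous (trunc_sqr K).
Proof.
move=> y; apply: (@continuous_min R R (fun y => y ^+ 2) (cst K)).
  exact: exprn_continuous.
exact: cst_continuous.
Qed.

Lemma measurable_trunc_sqr K : measurable_fun setT (trunc_sqr K).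
Proof. by apply: continuous_measurable_fun; exact: continuous_trunc_sqr. Qed.

Lemma gaussian_trunc_sqr e : 0 < e ->
  exists2 K, 0 < K & 1 - \int[gamma]_y trunc_sqr K y <= e.
Proof.
move=> e0.
have cv : \int[gamma]_y trunc_sqr n%:R y @[n --> \oo] --> \int[gamma]_y (y ^+ 2).
  have isq := @integrable_sqr_normal_prob R.
  apply: fine_cvg; rewrite fineK; last exact: integrable_fin_num.
  apply: (@dominated_cvg _ _ _ gamma setT measurableT
    (fun n y => (trunc_sqr n%:R y)%:E) _ (fun y => (y ^+ 2)%:E)) => //.
  - by move=> n; apply/measurable_EFinP; exact: measurable_trunc_sqr.
  - move=> y _; apply: cvg_near_cst.
    exists (Num.truncn (y ^+ 2)).+1 => // n /= yn; congr EFin.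
    by apply/min_idPl; rewrite (le_trans (ltW (truncnS_gt _)))// ler_nat.
  - move=> n y _; rewrite lee_fin ger0_norm ?trunc_sqr_le//.
    exact: trunc_sqr_ge0.
move: cv; rewrite Rintegral_sqr_normal_prob => /cvgrPdist_le/(_ _ e0)[n _ Hn].
exists n.+1%:R; first by rewrite ltr0n.
exact: le_trans (ler_norm _) (Hn n.+1 (leqnSn n)).
Qed.

End truncated_square.

Section asymptotics.
Context {R : realType} (mu : forall n, probability 'rV[R]_n R).
Local Notation gamma := (normal_prob (0 : R) 1).
Local Notation X := scaled_coord.
Local Notation cf s := (expR (- (s ^+ 2 / 2))).
Context (ex : forall n, exchangeable (mu n)).
Context (ss : forall n, sign_symmetric (mu n)).
Context (mu1 : forall n, (0 < n)%N -> {ae mu n, forall v, l2norm v = 1}).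
Context (cvg1 : forall h : R -> R, continuous h -> (exists M : R, forall x, `|h x| <= M) ->
  forall e : R, 0 < e -> \forall n \near \oo, forall j : 'I_n,
    `|\int[mu n]_v h (X j v) - \int[gamma]_x h x| <= e).
Context (cvg2 : forall h : R -> R, continuous h -> (exists M : R, forall x, `|h x| <= M) ->
  forall e : R, 0 < e -> \forall n \near \oo, forall i j : 'I_n, i != j ->
    `|\int[mu n]_v (h (X i v) * h (X j v)) - (\int[gamma]_x h x) ^+ 2| <= e).

(** With h centred, products over distinct coordinates have expectation tending to 0. Both terms of
    the second moment are made at most e^2/2, and lam = e gives e/2 + e^2/(2e) = e. The bound is
    uniform in b, which enters only through |cos| <= 1. *)
Lemma prod_cos_centered (h : R -> R) (eps e : R) : continuous h ->
  (exists M : R, forall x, `|h x| <= M) -> \int[gamma]_x h x = 0 -> 0 < eps -> 0 < e ->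
  \forall n \near \oo, forall (J : {set 'I_n}) (b : 'I_n -> R) j, j \notin J ->
    eps * n%:R <= #|~: J|%:R ->
    `|\int[mu n]_v ((\prod_(i in J) cos (b i * X i v)) * h (X j v))| <= e.
Proof.
move=> ch [B hB] h0 eps0 e0.
have e2 : 0 < e ^+ 2 / 2 by rewrite divr_gt0// exprn_gt0.
near=> n.
have n2 : (1 < n)%N by near: n; exact: nbhs_infty_gt.
have c2 : forall i j : 'I_n, i != j ->
    `|\int[mu n]_v (h (X i v) * h (X j v)) - (\int[gamma]_x h x) ^+ 2| <= e ^+ 2 / 2.
  by near: n; apply: cvg2 => //; exists B.
have nB : B ^+ 2 / (e ^+ 2 / 2 * eps) <= n%:R by near: n; exact: nbhs_infty_ger.
move=> J b j jJ mJ.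
have n0 : (0 < n)%N by rewrite (leq_trans _ n2).
have nR : 0 < n%:R :> R by rewrite ltr0n.
pose i0 : 'I_n := Ordinal n0; pose i1 : 'I_n := Ordinal n2.
have i01 : i0 != i1 by [].
have mh := continuous_measurable_fun ch.
have := Rintegral_prod_cos_average b (@ex n) jJ mh hB e0 i01.
move=> /le_trans; apply.
move/(_ i0 i1 i01) : c2; rewrite h0 expr0n subr0 => c2.
have B2 : B ^+ 2 / #|~: J|%:R <= e ^+ 2 / 2.
  have m0 : 0 < #|~: J|%:R :> R by rewrite (lt_le_trans _ mJ)// mulr_gt0.
  rewrite ler_pdivrMr//.
  move: nB; rewrite ler_pdivrMr; last by rewrite mulr_gt0.
  have := ler_wpM2l (ltW e2) mJ; lra.
rewrite -[leRHS]addr0 [leRHS](_ : _ = e / 2 + e ^+ 2 / (2 * e)); last first.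
  field; exact: lt0r_neq0.
rewrite lerD2l ler_wpM2r ?invr_ge0 ?mulr_ge0 ?(ltW e0)//; lra.
Unshelve. all: by end_near. Qed.


(* With z = min(y^2, K) in place of y^2, a Taylor polynomial approximates the
   cosine uniformly at order s^2; the truncation error is also O(s^2), weighted
   by the tail y^2 - min(y^2, K). *)
Lemma cos_trunc_taylor (t K e : R) : 0 < K -> 0 < e -> exists N : nat,
  forall s y, `|s| <= t ->
  `|cos (s * y) - \sum_(k < N) (- s ^+ 2) ^+ k / (k.*2)`!%:R * trunc_sqr K y ^+ k|
    <= s ^+ 2 * ((y ^+ 2 - trunc_sqr K y) / 2 + e * y ^+ 2).
Proof.
move=> K0 e0; have tK0 : 0 <= t ^+ 2 * K by rewrite mulr_ge0 ?sqr_ge0 ?ltW.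
have [N HN] := cos_sqrt_taylor tK0 e0.
exists N => s y st.
have q0 := trunc_sqr_ge0 y (ltW K0).
set q := trunc_sqr K y.
have z0 : 0 <= s ^+ 2 * q by rewrite mulr_ge0 ?sqr_ge0.
have zY : s ^+ 2 * q <= t ^+ 2 * K.
  rewrite ler_pM ?sqr_ge0// ?trunc_sqr_leK//.
  rewrite -(real_normK (num_real s)) lerXn2r// ?nnegrE//.
  exact: le_trans st.
have := HN _ (introT andP (conj z0 zY)).
under eq_bigr do rewrite -mulNr exprMn mulrAC.
(* The intermediate point cos (sqrt (s^2 q)) separates the truncation error, given by
   [ler_dist_cos], from the Taylor error e s^2 q <= e s^2 y^2. *)
move=> h; rewrite (le_trans (ler_distD (cos (Num.sqrt (s ^+ 2 * q))) _ _))//.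
rewrite mulrDr lerD//.
  rewrite (le_trans (ler_dist_cos _ _))// sqr_sqrtr// exprMn -mulrBr mulrA.
  rewrite ger0_norm// mulr_ge0 ?sqr_ge0// subr_ge0; exact: trunc_sqr_le.
apply: (le_trans h); rewrite mulrCA ler_wpM2l ?sqr_ge0// ler_wpM2l ?(ltW e0)//.
exact: trunc_sqr_le.
Qed.

(** As k > 0, one factor s^2 can be set aside. The base 1 + t^2 is at least 1, so the remaining
    exponent can be raised to N. *)
Lemma norm_taylor_coef_le (t s : R) (N k : nat) : `|s| <= t -> (0 < k < N)%N ->
  `|(- s ^+ 2) ^+ k / (k.*2)`!%:R| <= s ^+ 2 * (1 + t ^+ 2) ^+ N.
Proof.
move=> st /andP[k0 kN].
have s2t : s ^+ 2 <= 1 + t ^+ 2.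
  rewrite -[leLHS]add0r lerD// -(real_normK (num_real s)) lerXn2r ?nnegrE//.
  exact: le_trans st.
have t1 : 1 <= 1 + t ^+ 2 by rewrite lerDl sqr_ge0.
rewrite normrM normrX normrN (ger0_norm (sqr_ge0 s)).
rewrite (@le_trans _ _ ((s ^+ 2) ^+ k))//.
  rewrite (@ger0_norm _ _^-1) ?invr_ge0// ler_piMr//.
    by rewrite exprn_ge0// sqr_ge0.
  by rewrite invf_le1 ?ltr0n ?fact_gt0// ler1n fact_gt0.
rewrite -(prednK k0) exprS ler_wpM2l ?sqr_ge0//.
rewrite (@le_trans _ _ ((1 + t ^+ 2) ^+ k.-1))//.
  by rewrite lerXn2r ?nnegrE ?sqr_ge0// (le_trans ler01).
by rewrite ler_weXn2l// (leq_trans (leq_pred _))// ltnW.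
Qed.

(** The law is left general in order to treat both a coordinate with a weight W and the Gaussian
    itself. As E Y^2 = 1, the expected tail is 1 - E min(Y^2, K). *)
Lemma Rintegral_cos_sub_trunc d (T : measurableType d) (P : probability T R)
    (Y : T -> R) (W : T -> R) (s K e : R) (N : nat) :
  measurable_fun setT Y -> bounded_measurable W -> (forall x, `|W x| <= 1) -> 0 < K ->
  P.-integrable setT (EFin \o (fun x => Y x ^+ 2)) -> \int[P]_x (Y x ^+ 2) = 1 ->
  (forall y, `|cos (s * y) -
     \sum_(k < N) (- s ^+ 2) ^+ k / (k.*2)`!%:R * trunc_sqr K y ^+ k|
    <= s ^+ 2 * ((y ^+ 2 - trunc_sqr K y) / 2 + e * y ^+ 2)) ->
  `|\int[P]_x (W x * (cos (s * Y x) -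
     \sum_(k < N) (- s ^+ 2) ^+ k / (k.*2)`!%:R * trunc_sqr K (Y x) ^+ k))| <=
  s ^+ 2 * ((1 - \int[P]_x trunc_sqr K (Y x)) / 2 + e).
Proof.
move=> mY bW W1 K0 iY2 EY2 H.
have bq : bounded_measurable (fun x => trunc_sqr K (Y x)).
  split; first by apply: measurableT_comp => //; exact: measurable_trunc_sqr.
  by exists K => x; rewrite ger0_norm ?trunc_sqr_leK// trunc_sqr_ge0// ltW.
have bqk k : bounded_measurable (fun x => trunc_sqr K (Y x) ^+ k).
  elim: k => [|k IH]; first exact: bounded_measurable_cst.
  by under eq_fun do rewrite exprS; exact: bounded_measurableM.
have bD : bounded_measurable (fun x => W x * (cos (s * Y x) -
     \sum_(k < N) (- s ^+ 2) ^+ k / (k.*2)`!%:R * trunc_sqr K (Y x) ^+ k)).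
  apply: bounded_measurableM => //; apply: bounded_measurableB.
    by apply: bounded_measurable_cos; exact: measurable_funM.
  apply: bounded_measurable_sum => k; apply: bounded_measurableM => //.
  exact: bounded_measurable_cst.
have iD := bounded_measurable_integrable P bD.
have iq := bounded_measurable_integrable P bq.
have i1 := integrableZl measurableT (s ^+ 2 * (1 / 2 + e)) iY2.
have i2 := integrableZl measurableT (s ^+ 2 / 2) iq.
rewrite (le_trans (le_normr_Rintegral _ _))//.
apply: (@le_trans _ _ (\int[P]_x (s ^+ 2 * (1 / 2 + e) * Y x ^+ 2 -
    s ^+ 2 / 2 * trunc_sqr K (Y x)))).
  apply: le_Rintegral => //; [exact: integrable_norm|exact: (integrableB measurableT i1 i2)|].
  move=> x _; rewrite normrM.
  apply: (@le_trans _ _ (`|cos (s * Y x) -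
     \sum_(k < N) (- s ^+ 2) ^+ k / (k.*2)`!%:R * trunc_sqr K (Y x) ^+ k|)).
    by rewrite ler_piMl.
  by apply: (le_trans (H _)); rewrite le_eqVlt; apply/orP; left; apply/eqP; field.
rewrite RintegralB// RintegralZl// RintegralZl// EY2.
by rewrite le_eqVlt; apply/orP; left; apply/eqP; field.
Qed.

(** The path is cos (s x), then its polynomial G in the truncated square, then the Gaussian mean g0
    of G, then exp(-s^2/2). The outer comparisons are truncation and Taylor errors for the two laws;
    the middle one is [prod_cos_centered] for the finitely many powers in G. *)
Lemma prod_cos_gauss (t eps del : R) : 0 < eps -> 0 < del ->
  \forall n \near \oo, forall (J : {set 'I_n}) (b : 'I_n -> R) j s, j \notin J ->
    eps * n%:R <= #|~: J|%:R -> `|s| <= t ->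
    `|\int[mu n]_v ((\prod_(i in J) cos (b i * X i v)) * (cos (s * X j v) - cf s))|
      <= del * s ^+ 2.
Proof.
move=> eps0 del0.
(* The three errors are at most del/3, del/6 and del/4, times S = s^2. *)
have arith (S i1 i2 i3 r A q : R) : 0 <= S -> i1 <= S * ((1 - A) / 2 + del / 6) ->
    r <= S * ((1 - q) / 2 + del / 6) -> i2 <= S * (del / 6) -> i3 <= r ->
    1 - A <= del / 6 + del / 6 -> 1 - q <= del / 6 -> i1 + (i2 + i3) <= del * S.
  move=> S0 h1 hr h2 h3 /(ler_wpM2l S0) hA /(ler_wpM2l S0) hq.
  have := mulr_ge0 S0 (ltW del0); lra.
pose eta := del / 6.
have eta0 : 0 < eta by rewrite divr_gt0.
have [K K0 HK] := gaussian_trunc_sqr eta0.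
have [N HN] := cos_trunc_taylor t K0 eta0.
pose c := (1 + t ^+ 2) ^+ N.
have c0 : 0 < c by rewrite exprn_gt0// ltr_pwDl// sqr_ge0.
(* There are N terms with coefficients at most s^2 c; [N.+1] keeps the denominator positive. *)
pose e := eta / (N.+1%:R * c).
have e0 : 0 < e by rewrite divr_gt0// mulr_gt0.
pose g k := \int[gamma]_y (trunc_sqr K y ^+ k).
pose h k (y : R) := trunc_sqr K y ^+ k - g k.
have bqk k : exists M : R, forall y, `|trunc_sqr K y ^+ k| <= M.
  exists (K ^+ k) => y; rewrite normrX lerXn2r ?nnegrE ?(ltW K0)//.
  by rewrite ger0_norm ?trunc_sqr_leK// trunc_sqr_ge0// ltW.
have cqk k : continuous (fun y => trunc_sqr K y ^+ k).
  move=> y; apply: (@continuous_comp _ _ _ (trunc_sqr K) (fun z => z ^+ k)).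
    exact: continuous_trunc_sqr.
  exact: exprn_continuous.
have bmqk k : bounded_measurable (fun y : R => trunc_sqr K y ^+ k).
  by split; [exact: continuous_measurable_fun|exact: bqk].
have ch k : continuous (h k).
  by move=> y; apply: cvgB; [exact: cqk|exact: cvg_cst].
have bh k : exists M : R, forall y, `|h k y| <= M.
  have [M HM] := bqk k; exists (M + `|g k|) => y.
  by rewrite (le_trans (ler_normB _ _))// lerD.
have h0 k : \int[gamma]_y h k y = 0.
  rewrite RintegralB//; last 2 first.
  - exact: (bounded_measurable_integrable gamma (bmqk k)).
  - exact: (bounded_measurable_integrable gamma (bounded_measurable_cst _ _)).
  by rewrite Rintegral_probability_cst subrr.
have Hh : \forall n \near \oo, forall k : 'I_N, forall (J : {set 'I_n}) (b : 'I_n -> R) j,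
    j \notin J -> eps * n%:R <= #|~: J|%:R ->
    `|\int[mu n]_v ((\prod_(i in J) cos (b i * X i v)) * h k (X j v))| <= e.
  by apply: filter_forall => k; exact: prod_cos_centered.
(* The tail of X_j^2 beyond K is thus close to the Gaussian one, uniformly in j, since both second
   moments equal 1. *)
have Hq : \forall n \near \oo, forall j : 'I_n,
    `|\int[mu n]_v trunc_sqr K (X j v) - \int[gamma]_y trunc_sqr K y| <= eta.
  apply: cvg1 => //; first exact: continuous_trunc_sqr.
  by have [M HM] := bqk 1%N; exists M => y; have := HM y; rewrite expr1.
apply: filterS2 Hh Hq => n Hh Hq J b j s jJ mJ st.
have n0 : (0 < n)%N by exact: leq_ltn_trans (ltn_ord j).
pose W (v : 'rV[R]_n) := \prod_(i in J) cos (b i * X i v).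
have bW : bounded_measurable W by exact: bounded_measurable_prod_cos.
pose co k := (- s ^+ 2) ^+ k / (k.*2)`!%:R.
pose G y := \sum_(k < N) co k * trunc_sqr K y ^+ k.
have bck k : bounded_measurable (fun y : R => co k * trunc_sqr K y ^+ k).
  exact: (bounded_measurableM (bounded_measurable_cst _ (co k)) (bmqk k)).
have bG : bounded_measurable (G : R -> R) by exact: bounded_measurable_sum.
pose g0 := \int[gamma]_y G y.
have mX := @measurable_scaled_coord R n j.
have E1 : `|\int[mu n]_v (W v * (cos (s * X j v) - G (X j v)))| <=
    s ^+ 2 * ((1 - \int[mu n]_v trunc_sqr K (X j v)) / 2 + eta).
  apply: Rintegral_cos_sub_trunc => //.
  - exact: norm_prod_cos_le1.
  - exact: (integrable_scaled_coord_sqr j (@ex n) (mu1 n0)).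
  - exact: (Rintegral_scaled_coord_sqr j (@ex n) (mu1 n0)).
  - by move=> y; exact: HN.
have E2 : `|cf s - g0| <= s ^+ 2 * ((1 - \int[gamma]_y trunc_sqr K y) / 2 + eta).
  have := @Rintegral_cos_sub_trunc _ _ gamma id (cst 1) s K eta N.
  have -> : \int[gamma]_x (cst 1 x * (cos (s * id x) -
      \sum_(k < N) (- s ^+ 2) ^+ k / (k.*2)`!%:R * trunc_sqr K (id x) ^+ k)) =
      cf s - g0.
    under eq_Rintegral do rewrite mul1r.
    rewrite RintegralB//; last 2 first.
    - apply: bounded_measurable_integrable; apply: bounded_measurable_cos.
      exact: measurable_funM.
    - exact: bounded_measurable_integrable.
    by rewrite Rintegral_cos_normal_prob.
  apply => //.
  - exact: bounded_measurable_cst.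
  - by move=> x; rewrite normr1.
  - exact: integrable_sqr_normal_prob.
  - exact: Rintegral_sqr_normal_prob.
  - by move=> y; exact: HN.
have bGX : bounded_measurable (fun v => G (X j v)).
  have [mG [M GM]] := bG; split; last by exists M.
  exact: measurableT_comp.
have bhX k : bounded_measurable (fun v => h k (X j v)).
  have [M HM] := bh k; split; last by exists M.
  by apply: measurableT_comp => //; exact: continuous_measurable_fun.
have E3 : `|\int[mu n]_v (W v * (G (X j v) - g0))| <= s ^+ 2 * eta.
  have -> : \int[mu n]_v (W v * (G (X j v) - g0)) =
      \sum_(k < N) co k * \int[mu n]_v (W v * h k (X j v)).
    have -> : g0 = \sum_(k < N) co k * g k.
      rewrite /g0 Rintegral_sum; last first.
        by move=> k; exact: (bounded_measurable_integrable gamma (bck k)).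
      apply: eq_bigr => k _; rewrite RintegralZl//.
      exact: (bounded_measurable_integrable gamma (bmqk k)).
    transitivity (\sum_(k < N) \int[mu n]_v (co k * (W v * h k (X j v)))); last first.
      apply: eq_bigr => k _; rewrite RintegralZl//.
      by apply: bounded_measurable_integrable; exact: bounded_measurableM.
    rewrite -Rintegral_sum; last first.
      move=> k; apply: bounded_measurable_integrable.
      apply: bounded_measurableM; first exact: bounded_measurable_cst.
      exact: bounded_measurableM.
    apply: eq_Rintegral => v _; rewrite /G -sumrB mulr_sumr.
    by apply: eq_bigr => k _; rewrite /h; ring.
  rewrite (le_trans (ler_norm_sum _ _ _))//.
  apply: (@le_trans _ _ (\sum_(k < N) s ^+ 2 * c * e)).
    apply: ler_sum => k _; rewrite normrM.
    (* The coefficient of index 0 carries no factor s^2, but [h 0] vanishes identically. *)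
    have [k0|k0] := posnP k.
      have hk v : h k (X j v) = 0.
        rewrite /h k0 expr0 /g; under eq_Rintegral do rewrite expr0.
        by rewrite Rintegral_probability_cst subrr.
      under eq_Rintegral do rewrite hk mulr0.
      rewrite Rintegral_probability_cst normr0 mulr0.
      exact: (mulr_ge0 (mulr_ge0 (sqr_ge0 s) (ltW c0)) (ltW e0)).
    rewrite ler_pM//; last exact: Hh.
    by apply: norm_taylor_coef_le => //; rewrite k0 ltn_ord.
  rewrite sumr_const card_ord -mulr_natl.
  have -> : N%:R * (s ^+ 2 * c * e) = s ^+ 2 * (eta * (N%:R / N.+1%:R)).
    by rewrite /e invfM; set M := _.+1%:R^-1; field; exact: lt0r_neq0.
  rewrite ler_wpM2l ?sqr_ge0// ler_piMr ?(ltW eta0)//.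
  by rewrite ler_pdivrMr ?ltr0n// mul1r ler_nat.
have E4 : `|\int[mu n]_v (W v * (g0 - cf s))| <= `|cf s - g0|.
  have bc : bounded_measurable (fun _ : 'rV[R]_n => g0 - cf s) by exact: bounded_measurable_cst.
  rewrite (le_trans (le_normr_Rintegral _ _))//.
    by apply: bounded_measurable_integrable; exact: bounded_measurableM.
  rewrite -[leRHS](Rintegral_probability_cst (mu n)); apply: le_Rintegral => //.
  - apply: integrable_norm; apply: bounded_measurable_integrable.
    exact: bounded_measurableM.
  - by apply: bounded_measurable_integrable; exact: bounded_measurable_cst.
  - by move=> v _; rewrite normrM distrC ler_piMl// norm_prod_cos_le1.
have -> : \int[mu n]_v (W v * (cos (s * X j v) - cf s)) =
    \int[mu n]_v (W v * (cos (s * X j v) - G (X j v))) +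
    (\int[mu n]_v (W v * (G (X j v) - g0)) + \int[mu n]_v (W v * (g0 - cf s))).
  have b1 : bounded_measurable (fun v => W v * (cos (s * X j v) - G (X j v))).
    apply: bounded_measurableM => //; apply: bounded_measurableB => //.
    exact: bounded_measurable_cosX.
  have b2 : bounded_measurable (fun v => W v * (G (X j v) - g0)).
    apply: bounded_measurableM => //; apply: bounded_measurableB => //.
    exact: bounded_measurable_cst.
  have b3 : bounded_measurable (fun v => W v * (g0 - cf s)).
    by apply: bounded_measurableM => //; exact: bounded_measurable_cst.
  rewrite -RintegralD//; [|exact: bounded_measurable_integrable..].
  rewrite -RintegralD//.
  - by apply: eq_Rintegral => v _; ring.
  - exact: bounded_measurable_integrable.
  - by apply: bounded_measurable_integrable; exact: bounded_measurableD.
rewrite (le_trans (ler_normD _ _))//.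
apply: le_trans (lerD (lexx _) (ler_normD _ _)) _.
apply: (arith _ _ _ _ _ _ _ (sqr_ge0 s) E1 E2 E3 E4 _ HK).
have hA : \int[gamma]_y trunc_sqr K y - \int[mu n]_v trunc_sqr K (X j v) <= eta.
  by rewrite (le_trans (ler_norm _))// distrC; exact: Hq.
by apply: le_trans (lerD HK hA); rewrite addrA subrK.
Qed.

End asymptotics.

(** * Convergence of the linear combination against test functions *)

Section linear_combination.
Context {R : realType} (mu : forall n, probability 'rV[R]_n R).
Local Notation gamma := (normal_prob (0 : R) 1).
Local Notation X := scaled_coord.
Local Notation cf s := (expR (- (s ^+ 2 / 2))).
Context (ex : forall n, exchangeable (mu n)).
Context (ss : forall n, sign_symmetric (mu n)).
Context (mu1 : forall n, (0 < n)%N -> {ae mu n, forall v, l2norm v = 1}).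
Context (cvg1 : forall h : R -> R, continuous h -> (exists M : R, forall x, `|h x| <= M) ->
  forall e : R, 0 < e -> \forall n \near \oo, forall j : 'I_n,
    `|\int[mu n]_v h (X j v) - \int[gamma]_x h x| <= e).
Context (cvg2 : forall h : R -> R, continuous h -> (exists M : R, forall x, `|h x| <= M) ->
  forall e : R, 0 < e -> \forall n \near \oo, forall i j : 'I_n, i != j ->
    `|\int[mu n]_v (h (X i v) * h (X j v)) - (\int[gamma]_x h x) ^+ 2| <= e).
Context (a : forall n, 'I_n -> R).
Context (a1 : forall n, (0 < n)%N -> \sum_j a (n := n) j ^+ 2 = 1).

Definition lin_comb n (v : 'rV[R]_n) : R := \sum_j a j * X j v.

Lemma measurable_lin_comb n : measurable_fun setT (@lin_comb n).
Proof. exact: measurable_linear_comb. Qed.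

Lemma cvg_cos_lin_comb (t : R) :
  \int[mu n]_v cos (t * lin_comb v) @[n --> \oo] --> \int[gamma]_y cos (t * y).
Proof.
rewrite Rintegral_cos_normal_prob; apply/cvgrPdist_le => e e0.
(* With m just above eps n, 2m/n <= 3 eps as soon as n >= 2/eps, and del = eps: the total is 4 eps
   t^2 <= e. The cap 1/4 gives 2m <= n once n >= 4. *)
pose eps := Num.min (e / (4 * (t ^+ 2 + 1))) (1 / 4).
have t20 := sqr_ge0 t.
have eps0 : 0 < eps.
  by rewrite lt_min !divr_gt0// mulr_gt0// ltr_wpDl.
have epse : t ^+ 2 * (4 * eps) <= e.
  have : eps <= e / (4 * (t ^+ 2 + 1)) by rewrite ge_min lexx.
  rewrite ler_pdivlMr; last by rewrite mulr_gt0// ltr_wpDl.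
  by move=> h; have := ltW eps0; nra.
have eps4 : eps <= 1 / 4 by rewrite ge_min lexx orbT.
have key := prod_cos_gauss ex mu1 cvg1 cvg2 `|t| eps0 eps0.
near=> n.
have keyn : forall (J : {set 'I_n}) (b : 'I_n -> R) j s, j \notin J ->
    eps * n%:R <= #|~: J|%:R -> `|s| <= `|t| ->
    `|\int[mu n]_v ((\prod_(i in J) cos (b i * X i v)) * (cos (s * X j v) - cf s))|
      <= eps * s ^+ 2.
  by near: n; exact: key.
have n4 : (3 < n)%N by near: n; exact: nbhs_infty_gt.
have neps : 2 / eps <= n%:R by near: n; exact: nbhs_infty_ger.
have n0 : (0 < n)%N by rewrite (leq_trans _ n4).
have nR : 0 < n%:R :> R by rewrite ltr0n.
have n4R : 4 <= n%:R :> R by rewrite -[4]/(4%:R) ler_nat.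
rewrite ler_pdivrMr// in neps.
pose m := (Num.truncn (eps * n%:R)).+1.
have en0 : 0 <= eps * n%:R by rewrite mulr_ge0// ltW.
have mlb : eps * n%:R < m%:R by exact: truncnS_gt.
have mub : m%:R <= eps * n%:R + 1.
  by rewrite /m -natr1 lerD2r; have /andP[] := truncn_itv en0.
have mn : (m.*2 <= n)%N.
  rewrite -(@ler_nat R) -muln2 natrM; nra.
have := @Rintegral_prod_cos_close R n (mu n) (@ex n) (mu1 n0) (@a n) t (a1 n0) m eps mn (ltW eps0).
have -> : \int[mu n]_v cos (t * lin_comb v) = \int[mu n]_v \prod_i cos (t * a i * X i v).
  rewrite -(Rintegral_cos_linear_comb _ (@ss n)); apply: eq_Rintegral => v _.
  by rewrite /lin_comb mulr_sumr; congr cos; apply: eq_bigr => i _; rewrite mulrA.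
rewrite distrC => /(_ _)/le_trans; apply.
  move=> J' j jJ' mJ'; apply: keyn => //.
    by rewrite (le_trans (ltW mlb))// ler_nat.
  rewrite normrM ler_piMr// -[leRHS]sqrtr1 -sqrtr_sqr ler_wsqrtr//.
  rewrite -(a1 n0) [leRHS](bigD1 j)//= lerDl sumr_ge0// => i _; exact: sqr_ge0.
apply: le_trans epse; rewrite ler_wpM2l//.
have : 2 * m%:R / n%:R <= 3 * eps by rewrite ler_pdivrMr//; lra.
lra.
Unshelve. all: by end_near. Qed.

Definition cvg_test (F : R -> R) :=
  \int[mu n]_v F (lin_comb v) @[n --> \oo] --> \int[gamma]_y F y.

Lemma bounded_measurable_lin_comb (F : R -> R) n : bounded_measurable F ->
  bounded_measurable (F \o @lin_comb n).
Proof.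
move=> [mF [M FM]]; split; last by exists M => v; exact: FM.
by apply: measurableT_comp => //; exact: measurable_lin_comb.
Qed.

Lemma cvg_test_comb (c : R) (F G : R -> R) : bounded_measurable F ->
  bounded_measurable G -> cvg_test F -> cvg_test G ->
  cvg_test (fun y => c * F y + G y).
Proof.
move=> bF bG cF cG; rewrite /cvg_test.
have bcF : bounded_measurable (fun y => c * F y).
  exact: (bounded_measurableM (bounded_measurable_cst _ c) bF).
rewrite RintegralD//; [|exact: (bounded_measurable_integrable gamma)..].
rewrite RintegralZl//; last exact: (bounded_measurable_integrable gamma).
have -> : (fun n => \int[mu n]_v (c * F (lin_comb v) + G (lin_comb v))) =
    (fun n => c * \int[mu n]_v F (lin_comb v) + \int[mu n]_v G (lin_comb v)).
  apply/funext => n.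
  have bFn := bounded_measurable_lin_comb n bF.
  have bGn := bounded_measurable_lin_comb n bG.
  rewrite RintegralD//; last 2 first.
  - apply: bounded_measurable_integrable.
    exact: (bounded_measurable_lin_comb n bcF).
  - exact: bounded_measurable_integrable.
  by rewrite RintegralZl//; exact: bounded_measurable_integrable.
by apply: cvgD => //; apply: cvgM => //; exact: cvg_cst.
Qed.

Lemma bounded_measurable_cos_bern N (f : nat -> R) (t : R) :
  bounded_measurable (cos_bern N f t).
Proof.
rewrite /cos_bern; elim: N f => [|N IH] f /=; first exact: bounded_measurable_cst.
have bp : bounded_measurable (fun x => (1 + cos (t * x)) / 2).
  apply: bounded_measurableM; last exact: bounded_measurable_cst.
  apply: bounded_measurableD; first exact: bounded_measurable_cst.
  by apply: bounded_measurable_cos; exact: measurable_funM.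
apply: bounded_measurableD; apply: bounded_measurableM => //.
by apply: bounded_measurableB => //; exact: bounded_measurable_cst.
Qed.

(* The factor [cos (b * y)] makes the induction go through: multiplying by
   [cos (t * y)] only shifts [b] by [t] and [- t]. *)
Lemma cvg_test_cos_bern N (f : nat -> R) (t b : R) :
  cvg_test (fun y => cos_bern N f t y * cos (b * y)).
Proof.
have bcos (c : R) : bounded_measurable (fun y : R => cos (c * y)).
  by apply: bounded_measurable_cos; exact: measurable_funM.
have bB N' f' (c : R) : bounded_measurable (fun y => cos_bern N' f' t y * cos (c * y)).
  exact: (bounded_measurableM (bounded_measurable_cos_bern N' f' t) (bcos c)).
have b0 : bounded_measurable (fun _ : R => 0 : R) by exact: bounded_measurable_cst.
have c0 : cvg_test (fun=> 0).
  rewrite /cvg_test Rintegral_probability_cst.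
  under eq_fun do rewrite Rintegral_probability_cst.
  exact: cvg_cst.
elim: N f b => [|N IH] f b.
  have := @cvg_test_comb (f 0%N) _ _ (bcos b) b0 (@cvg_cos_lin_comb b) c0.
  by congr cvg_test; apply/funext => y; rewrite addr0.
have comb c f' b' G : bounded_measurable G /\ cvg_test G ->
    bounded_measurable (fun y => c * (cos_bern N f' t y * cos (b' * y)) + G y) /\
    cvg_test (fun y => c * (cos_bern N f' t y * cos (b' * y)) + G y).
  move=> [bG cG]; split; last exact: cvg_test_comb.
  exact: (bounded_measurableD
    (bounded_measurableM (bounded_measurable_cst _ c) (bB N f' b')) bG).
(* With p = (1 + cos (t y))/2, p cos (b y) is 1/2 cos (b y) plus 1/4 of each of cos ((t + b) y) and
   cos ((t - b) y); for 1 - p the last two coefficients change sign. *)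
have [_] := comb (1 / 2) (f \o S) b _ (comb (1 / 4) (f \o S) (t + b) _
  (comb (1 / 4) (f \o S) (t - b) _ (comb (1 / 2) f b _ (comb (- (1 / 4)) f (t + b) _
  (comb (- (1 / 4)) f (t - b) _ (conj b0 c0)))))).
congr cvg_test; apply/funext => y; rewrite /cos_bern/=.
rewrite (mulrDl t b) (mulrBl y t b) cosD cosB.
by field.
Qed.

(** Outside [-L, L] the difference is at most 2M <= 2M Y^2/L^2, and E Y^2 = 1. This serves for the
    linear combination and for the Gaussian alike. *)
Lemma Rintegral_cos_bern_close d (T : measurableType d) (P : probability T R)
    (Y : T -> R) (g h : R -> R) (M L e : R) :
  measurable_fun setT Y ->
  P.-integrable setT (EFin \o (fun x => Y x ^+ 2)) -> \int[P]_x (Y x ^+ 2) = 1 ->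
  bounded_measurable g -> bounded_measurable h -> 0 < L -> 0 <= e ->
  (forall y, `|g y| <= M) -> (forall y, `|h y| <= M) ->
  (forall y, `|y| <= L -> `|g y - h y| <= e) ->
  `|\int[P]_x g (Y x) - \int[P]_x h (Y x)| <= e + 2 * M / L ^+ 2.
Proof.
move=> mY iY EY bg bh L0 e0 gM hM gh.
have M0 : 0 <= M by rewrite (le_trans _ (gM 0)).
have c0 : 0 <= 2 * M / L ^+ 2 by rewrite divr_ge0 ?sqr_ge0// mulr_ge0.
have bY (k : R -> R) : bounded_measurable k -> bounded_measurable (k \o Y).
  by move=> [mk [N kN]]; split; [exact: measurableT_comp|exists N => x; exact: kN].
have ig := bounded_measurable_integrable P (bY _ bg).
have ih := bounded_measurable_integrable P (bY _ bh).
have ib := bounded_measurable_integrable P (bounded_measurableB (bY _ bg) (bY _ bh)).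
have i1 := integrableZl measurableT (2 * M / L ^+ 2) iY.
have i0 : P.-integrable setT (EFin \o (fun=> e)).
  by apply: bounded_measurable_integrable; exact: bounded_measurable_cst.
rewrite -RintegralB// (le_trans (le_normr_Rintegral _ _))//.
apply: (@le_trans _ _ (\int[P]_x (e + 2 * M / L ^+ 2 * Y x ^+ 2))).
  apply: le_Rintegral => //; [exact: integrable_norm|exact: (integrableD measurableT i0 i1)|].
  move=> x _; have [YL|/ltW YL] := leP `|Y x| L.
    by rewrite (le_trans (gh _ YL))// lerDl (mulr_ge0 c0 (sqr_ge0 _)).
  apply: (@le_trans _ _ (2 * M)).
    by rewrite (le_trans (ler_normB _ _))// mulr_natl mulr2n lerD.
  rewrite -[leLHS]add0r lerD// mulrAC ler_pdivlMr ?exprn_gt0//.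
  rewrite ler_wpM2l ?mulr_ge0// -(real_normK (num_real (Y x))) lerXn2r// nnegrE ltW//.
rewrite RintegralD// Rintegral_probability_cst RintegralZl//.
by rewrite EY mulr1.
Qed.

Lemma cvg_test_even (g : R -> R) (M : R) : continuous g ->
  (forall x, g (- x) = g x) -> (forall x, `|g x| <= M) -> cvg_test g.
Proof.
move=> cg geven gM; apply/cvgrPdist_le => e e0.
have M0 : 0 <= M by rewrite (le_trans _ (gM 0)).
(* Chosen for 2M/L^2 <= e/8, with M + 1 to keep L positive. The errors sum to e/4 for each law, plus
   e/8 for the convergence. *)
pose L := Num.sqrt (16 * (M + 1) / e).
have L20 : 0 < 16 * (M + 1) / e by rewrite divr_gt0// mulr_gt0// ltr_wpDl.
have L0 : 0 < L by rewrite sqrtr_gt0.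
have L2 : 2 * M / L ^+ 2 <= e / 8.
  rewrite ler_pdivrMr ?exprn_gt0// sqr_sqrtr ?(ltW L20)//.
  have -> : e / 8 * (16 * (M + 1) / e) = 2 * (M + 1) by field; exact: lt0r_neq0.
  lra.
have e8 : 0 < e / 8 by rewrite divr_gt0.
have [N [f [t [close hM]]]] := even_cos_approx cg geven gM L0 e8.
have bg : bounded_measurable g by split; [exact: continuous_measurable_fun|exists M].
have bh := bounded_measurable_cos_bern N f t.
have := @cvg_test_cos_bern N f t 0.
have -> : (fun y => cos_bern N f t y * cos (0 * y)) = cos_bern N f t.
  by apply/funext => y; rewrite mul0r cos0 mulr1.
move=> /cvgrPdist_le/(_ _ e8) ch.
have Hg : `|\int[gamma]_y g y - \int[gamma]_y cos_bern N f t y| <= e / 8 + 2 * M / L ^+ 2.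
  apply: (@Rintegral_cos_bern_close _ _ gamma id) => //.
  - exact: integrable_sqr_normal_prob.
  - exact: Rintegral_sqr_normal_prob.
  - exact: ltW.
near=> n.
have n0 : (0 < n)%N by near: n; exact: nbhs_infty_gt.
have chn : `|\int[gamma]_y cos_bern N f t y - \int[mu n]_v cos_bern N f t (lin_comb v)|
    <= e / 8 by near: n; exact: ch.
have Hn : `|\int[mu n]_v g (lin_comb v) - \int[mu n]_v cos_bern N f t (lin_comb v)| <=
    e / 8 + 2 * M / L ^+ 2.
  apply: Rintegral_cos_bern_close => //.
  - exact: measurable_lin_comb.
  - exact: (integrable_linear_comb_sqr _ (@ex n) (mu1 n0)).
  - by rewrite (Rintegral_linear_comb_sqr _ (@ex n) (@ss n) (mu1 n0)) a1.
  - exact: ltW.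
rewrite (le_trans (ler_distD (\int[gamma]_y cos_bern N f t y) _ _))//.
have := ler_distD (\int[mu n]_v cos_bern N f t (lin_comb v))
  (\int[gamma]_y cos_bern N f t y) (\int[mu n]_v g (lin_comb v)).
rewrite [`|\int[mu n]_v cos_bern N f t (lin_comb v) - _|]distrC.
move: (e0) Hg Hn chn L2; clear; lra.
Unshelve. all: by end_near. Qed.

(** The Gaussian inherits this from the laws of single coordinates, which are symmetric and converge
    to it. *)
Lemma Rintegral_normal_prob_opp (f : R -> R) (M : R) : continuous f ->
  (forall x, `|f x| <= M) -> \int[gamma]_x f (- x) = \int[gamma]_x f x.
Proof.
move=> cf fM; have cfN : continuous (fun x : R => f (- x)).
  by move=> x; apply: continuous_comp; [exact: opp_continuous|exact: cf].
apply/eqP; rewrite -subr_eq0 -normr_le0; apply/ler_addgt0Pr => e e0; rewrite add0r.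
have e2 : 0 < e / 2 by rewrite divr_gt0.
have H1 := cvg1 cf (ex_intro _ M fM) e2.
have H2 := cvg1 cfN (ex_intro _ M (fun x => fM (- x))) e2.
have [n [[H1n H2n] n0]] : exists n, ((forall j : 'I_n,
    `|\int[mu n]_v f (X j v) - \int[gamma]_x f x| <= e / 2) /\
    (forall j : 'I_n,
    `|\int[mu n]_v f (- X j v) - \int[gamma]_x f (- x)| <= e / 2)) /\ (0 < n)%N.
  near \oo => n; exists n; split; last by near: n; exact: nbhs_infty_gt.
  by split; near: n.
pose j := Ordinal n0.
have E : \int[mu n]_v f (- X j v) = \int[mu n]_v f (X j v).
  rewrite -(Rintegral_flip_signs xpredT (@ss n)); last first.
    apply: (measurableT_comp (continuous_measurable_fun cfN)).
    exact: measurable_scaled_coord.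
  by apply: eq_Rintegral => v _; rewrite scaled_coord_flip_signs expr1 mulN1r opprK.
have := H1n j; have := H2n j; rewrite E distrC => h2 h1.
rewrite (le_trans (ler_distD (\int[mu n]_v f (X j v)) _ _))//.
by rewrite [leRHS](splitr e) lerD.
Unshelve. all: by end_near. Qed.

(** Under both laws f and its even part have the same integral: by flipping all signs for the linear
    combination, by [Rintegral_normal_prob_opp] for the limit. *)
Lemma cvg_test_continuous (f : R -> R) (M : R) : continuous f ->
  (forall x, `|f x| <= M) -> cvg_test f.
Proof.
move=> cf fM; have cfN : continuous (fun x : R => f (- x)).
  by move=> x; apply: continuous_comp; [exact: opp_continuous|exact: cf].
have bf : bounded_measurable f by split; [exact: continuous_measurable_fun|exists M].
have bfN : bounded_measurable (fun x : R => f (- x)).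
  by split; [exact: continuous_measurable_fun|exists M].
pose g (x : R) := (f x + f (- x)) / 2.
have : cvg_test g.
  apply: (@cvg_test_even _ M).
  - by move=> x; apply: cvgM; [apply: cvgD; [exact: cf|exact: cfN]|exact: cvg_cst].
  - by move=> x; rewrite /g opprK addrC.
  - move=> x; rewrite /g normrM (@ger0_norm _ 2^-1)// ler_pdivrMr//.
    by rewrite (le_trans (ler_normD _ _))// mulr_natr mulr2n lerD.
have half d (T : measurableType d) (P : probability T R) (Y : T -> R) :
    measurable_fun setT Y -> \int[P]_x f (- Y x) = \int[P]_x f (Y x) ->
    \int[P]_x g (Y x) = \int[P]_x f (Y x).
  move=> mY E.
  have bY (k : R -> R) : bounded_measurable k -> bounded_measurable (k \o Y).
    by move=> [mk [N kN]]; split; [exact: measurableT_comp|exists N => x; exact: kN].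
  have i1 := bounded_measurable_integrable P (bY _ bf).
  have i2 := bounded_measurable_integrable P (bY _ bfN).
  rewrite RintegralZr//; last exact: (integrableD measurableT i1 i2).
  by rewrite RintegralD// E; field.
rewrite /cvg_test (@half _ _ gamma id)//; last exact: (@Rintegral_normal_prob_opp _ M).
apply: cvg_trans; apply: near_eq_cvg; near=> n.
apply: half; first exact: measurable_lin_comb.
rewrite -(Rintegral_flip_signs xpredT (@ss n)); last first.
  by case: (bounded_measurable_lin_comb n bfN).
apply: eq_Rintegral => v _; congr f; rewrite /lin_comb -sumrN.
by apply: eq_bigr => j _; rewrite scaled_coord_flip_signs expr1 mulN1r mulrN opprK.
Unshelve. all: by end_near. Qed.

End linear_combination.

(** * Passing to the limit laws *)

Section independence.
Context d (T : measurableType d) (R : realType) (P : probability T R).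
Local Notation gamma := (normal_prob (0 : R) 1).

Lemma Rintegral_std_normal (Z : {RV P >-> R}) (h : R -> R) :
  (forall A : set R, measurable A -> distribution P Z A = gamma A) ->
  bounded_measurable h -> \int[P]_x h (Z x) = \int[gamma]_y h y.
Proof.
move=> Zg [mh [M hM]]; rewrite /Rintegral; congr fine.
have mZ : measurable_fun setT (Z : T -> measurableTypeR R) by exact: (@measurable_funPT _ _ _ _ Z).
rewrite -[LHS](@integral_pushforward _ _ T (measurableTypeR R) R Z mZ P setT (EFin \o h))//.
- by apply: eq_measure_integral => A mA _; exact: Zg.
- by apply/measurable_EFinP.
- apply: (@bounded_integrable _ _ _ P (h \o Z) M) => [|x]; last exact: hM.
  exact: (measurableT_comp mh (@measurable_funPT _ _ _ _ Z)).
Qed.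

(** Independence identifies the law of the pair with the product measure on rectangles, hence
    everywhere; Fubini then splits the integral. *)
Lemma Rintegral_iid_std_normal_prod (Z : 'I_2 -> {RV P >-> R}) (h : R -> R) :
  iid_std_normal Z -> bounded_measurable h ->
  \int[P]_x (h (Z ord0 x) * h (Z ord_max x)) = (\int[gamma]_y h y) ^+ 2.
Proof.
move=> [indep Zg] bh.
pose Y x : measurableTypeR R * measurableTypeR R := (Z ord0 x, Z ord_max x).
have mZ i : measurable_fun setT (Z i : T -> measurableTypeR R).
  exact: (@measurable_funPT _ _ _ _ (Z i)).
have mY : measurable_fun setT Y by exact: (measurable_fun_pair (mZ _) (mZ _)).
have joint (A B : set R) : measurable A -> measurable B ->
    pushforward P Y (A `*` B) = (gamma A * gamma B)%E.
  move=> mA mB.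
  pose AB (i : 'I_2) := if i == ord0 then A else B.
  have mAB i : measurable (AB i) by rewrite /AB; case: ifP.
  have := indep finset.setT AB mAB.
  have -> : [set w | forall i, i \in [set: 'I_2]%SET -> AB i (Z i w)] =
      Y @^-1` (A `*` B).
    apply/seteqP; split => w /= H.
      by split; [apply: (H ord0)|apply: (H ord_max)]; rewrite inE.
    move=> i _; rewrite /AB; case: ifPn => [/eqP ->|n0i]; first by case: H.
    have -> : i = ord_max by move: n0i; case: i => [[|[|//]]] //= p _; exact: val_inj.
    by case: H.
  rewrite /pushforward => ->.
  rewrite (eq_bigl xpredT); last by move=> i; rewrite inE.
  rewrite big_ord_recl big_ord1 (_ : lift ord0 ord0 = ord_max); last exact: val_inj.
  by rewrite -(Zg ord0 A)// -(Zg ord_max B).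
have prodE (A : set (measurableTypeR R * measurableTypeR R)) :
    measurable A -> (gamma \x gamma)%E A = pushforward P Y A.
  exact: (@product_measure_unique _ _ _ _ R gamma gamma (pushforward P Y) joint).
have [mh [M hM]] := bh.
pose F (z : measurableTypeR R * measurableTypeR R) : R := h z.1 * h z.2.
have mF : measurable_fun setT F.
  by apply: measurable_funM; apply: measurableT_comp => //.
have FM z : `|F z| <= M * M by rewrite normrM ler_pM.
have iF : (gamma \x gamma)%E.-integrable setT (EFin \o F).
  apply: measurable_bounded_integrable => //.
    rewrite [ltLHS](_ : _ = 1%E) ?ltry//; apply: etrans (prodE _ measurableT) _.
    by rewrite /pushforward preimage_setT probability_setT.
  exists (M * M); split=> [|x Mx y _]; first exact: num_real.
  by rewrite /= (le_trans (FM y))// ltW.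
have ih : gamma.-integrable setT (EFin \o h).
  exact: (bounded_measurable_integrable gamma bh).
transitivity (fine (\int[pushforward P Y]_z (F z)%:E)%E).
  rewrite /Rintegral; congr fine; rewrite (integral_pushforward mY)//.
    exact/measurable_EFinP.
  apply: (@bounded_integrable _ _ _ P (F \o Y) (M * M)) => [|x]; last exact: FM.
  exact: (measurableT_comp mF mY).
transitivity (fine (\int[gamma \x gamma]_z (F z)%:E)%E).
  by congr fine; apply: eq_measure_integral => A mA _; exact/esym/prodE.
rewrite -(integral12_prod_meas1 iF) /fubini_F.
transitivity (fine (\int[gamma]_x ((h x)%:E * \int[gamma]_y (h y)%:E))%E).
  by congr fine; apply: eq_integral => x _; rewrite -integralZl.
have fh := integrable_fin_num measurableT ih.
by rewrite -(fineK fh) integralZr// fineM// fineK.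
Qed.

End independence.

Section law_of_random_vector.
Context {R : realType}.
Local Notation gamma := (normal_prob (0 : R) 1).
Local Notation X := scaled_coord.

Lemma coordinate_lt n (x : 'rV[R]_n) (i : nat) (lt_in : (i < n)%N) :
  coordinate x i = x ord0 (Ordinal lt_in).
Proof. by rewrite /coordinate insubT. Qed.

Lemma Rintegral_distribution d (T : measurableType d) (P : probability T R) n
    (u : {RV P >-> 'rV[R]_n}) (F : 'rV[R]_n -> R) : bounded_measurable F ->
  \int[distribution P u]_v F v = \int[P]_w F (u w).
Proof.
move=> [mF [M FM]]; congr fine.
rewrite (@integral_distribution _ _ _ _ _ P u (EFin \o F))//.
  exact/measurable_EFinP.
apply: (@bounded_integrable _ _ _ P (F \o u) M) => [|w]; last exact: FM.
exact: measurableT_comp.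
Qed.

Context (d : nat -> measure_display) (T : forall n, measurableType (d n))
  (P : forall n, probability (T n) R) (u : forall n, {RV (P n) >-> 'rV[R]_n}).
Local Notation mu n := (distribution (P n) (u n)).

Lemma distribution_exchangeable n :
  (forall s : 'S_n, equal_in_law (P n) (fun w => col_perm s (u n w)) (u n)) ->
  exchangeable (mu n).
Proof. by move=> H s A mA; exact: (H s A mA). Qed.

Lemma distribution_sign_symmetric n :
  (forall e : 'I_n -> bool,
     equal_in_law (P n) (fun w => flip_signs e (u n w)) (u n)) ->
  sign_symmetric (mu n).
Proof. by move=> H e A mA; exact: (H e A mA). Qed.

Lemma measurable_l2norm n : measurable_fun setT (@l2norm R n).
Proof.
apply: (measurableT_comp (continuous_measurable_fun (@sqrt_continuous R))).
apply: measurable_sum => i.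
by apply: measurable_funM; exact: measurable_coord.
Qed.

Lemma distribution_unit n : {ae P n, forall w, l2norm (u n w) = 1} ->
  {ae mu n, forall v, l2norm v = 1}.
Proof.
move=> H; exists (~` (@l2norm R n @^-1` [set 1])); split => //.
- apply: measurableC; rewrite -[X in measurable X]setTI.
  by apply: measurable_l2norm => //; exact: measurable_set1.
- have mA : measurable (~` (@l2norm R n @^-1` [set 1])).
    apply: measurableC; rewrite -[X in measurable X]setTI.
    by apply: measurable_l2norm => //; exact: measurable_set1.
  rewrite /distribution /pushforward.
  apply/negligibleP => //.
  by rewrite -[X in measurable X]setTI; exact: measurable_funPT.
Qed.

(** Expectations are extended reals; integrability makes the limit finite, so that [fine] preserves
    the convergence. *)
Lemma cvg_in_distribution_Rintegral k (Y : forall n, T n -> 'rV[R]_k)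
    d' (Om : measurableType d') (Q : probability Om R) (Z : Om -> 'rV[R]_k)
    (f : 'rV[R]_k -> R) :
  cvg_in_distribution P Y Q Z -> continuous f -> (exists M : R, forall x, `|f x| <= M) ->
  Q.-integrable setT (EFin \o (f \o Z)) ->
  \int[P n]_w f (Y n w) @[n --> \oo] --> \int[Q]_z f (Z z).
Proof.
move=> H cf bf iZ; have := H f cf bf; rewrite unlock.
rewrite -[X in _ --> X -> _](fineK (integrable_fin_num measurableT iZ)).
by move=> /fine_cvg.
Qed.

Context (u_exchangeable : forall n, exchangeable (mu n)).
Context (u_normal : forall k (i : 'I_k -> nat), injective i ->
  exists (d' : measure_display) (S : measurableType d') (Q : probability S R)
      (Z : 'I_k -> {RV Q >-> R}),
    iid_std_normal Z /\
    cvg_in_distribution P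
      (fun n w => \row_(j < k) (Num.sqrt n%:R * coordinate (u n w) (i j)))
      Q (fun z => \row_(j < k) Z j z)).

Lemma bounded_measurable_scaled_coord n (j : 'I_n) (h : R -> R) :
  bounded_measurable h -> bounded_measurable (fun v => h (X j v)).
Proof.
move=> [mh [M hM]]; split; last by exists M => v; exact: hM.
by apply: (measurableT_comp mh); exact: measurable_scaled_coord.
Qed.

(** The limit law is applied to coordinate 0 only; exchangeability makes the integral independent of
    j, whence the uniformity. *)
Lemma cvg_single_coordinate (h : R -> R) : continuous h ->
  (exists M : R, forall x, `|h x| <= M) ->
  forall e : R, 0 < e -> \forall n \near \oo, forall j : 'I_n,
    `|\int[mu n]_v h (X j v) - \int[gamma]_x h x| <= e.
Proof.
move=> ch bh e e0.
have bmh : bounded_measurable h by split => //; exact: continuous_measurable_fun.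
have inj0 : injective (fun _ : 'I_1 => 0%N) by move=> x y _; rewrite (ord1 x) (ord1 y).
have [d' [S [Q [Z [[_ Zg] cZ]]]]] := u_normal inj0.
pose f (r : 'rV[R]_1) := h (r ord0 ord0).
have cf : continuous f.
  move=> r; apply: (@continuous_comp _ _ _ (fun r : 'rV[R]_1 => r ord0 ord0) h).
    exact: coord_continuous.
  exact: ch.
have bf : exists M : R, forall r, `|f r| <= M.
  by have [M hM] := bh; exists M => r; exact: hM.
have fZ z : f (\row_j Z j z) = h (Z ord0 z) by rewrite /f mxE.
have iZ : Q.-integrable setT (EFin \o (f \o (fun z => \row_j Z j z))).
  have [M hM] := bh.
  apply: (@bounded_integrable _ _ _ _ _ M) => [|z]; last exact: hM.
  rewrite (_ : _ \o _ = fun z => h (Z ord0 z)); last by apply/funext => z; exact: fZ.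
  by case: bmh => mh _; exact: (measurableT_comp mh (@measurable_funPT _ _ _ _ (Z ord0))).
have := cvg_in_distribution_Rintegral cZ cf bf iZ.
under [X in _ --> X]eq_Rintegral do rewrite fZ.
rewrite (Rintegral_std_normal (Zg ord0) bmh) => /cvgrPdist_le/(_ _ e0) H.
have H0 : \forall n \near \oo, (0 < n)%N by exact: nbhs_infty_gt.
apply: filterS2 H H0 => n H n0 j.
rewrite distrC; apply: le_trans H; rewrite le_eqVlt; apply/orP; left; apply/eqP.
congr (`|_ - _|); pose j0 := Ordinal n0.
transitivity (\int[mu n]_v h (X j0 v)).
  rewrite -(Rintegral_col_perm (tperm j0 j) (@u_exchangeable n)); last first.
    by case: (bounded_measurable_scaled_coord j bmh).
  by apply: eq_Rintegral => v _; rewrite scaled_coord_col_perm tpermR.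
rewrite Rintegral_distribution; last exact: bounded_measurable_scaled_coord.
by apply: eq_Rintegral => w _; rewrite /f mxE coordinate_lt.
Qed.

(** Likewise with coordinates 0 and 1, which a permutation carries to any pair of distinct
    indices. *)
Lemma cvg_pair_coordinates (h : R -> R) : continuous h ->
  (exists M : R, forall x, `|h x| <= M) ->
  forall e : R, 0 < e -> \forall n \near \oo, forall i j : 'I_n, i != j ->
    `|\int[mu n]_v (h (X i v) * h (X j v)) - (\int[gamma]_x h x) ^+ 2| <= e.
Proof.
move=> ch bh e e0.
have bmh : bounded_measurable h by split => //; exact: continuous_measurable_fun.
have [d' [S [Q [Z [Zg cZ]]]]] := u_normal (@ord_inj 2).
pose f (r : 'rV[R]_2) := h (r ord0 ord0) * h (r ord0 ord_max).
have cf : continuous f.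
  have chr (i : 'I_2) : continuous (fun r : 'rV[R]_2 => h (r ord0 i)).
    move=> r; apply: (@continuous_comp _ _ _ (fun r : 'rV[R]_2 => r ord0 i) h).
      exact: coord_continuous.
    exact: ch.
  by move=> r; apply: (@continuousM _ _ _ _ r); exact: chr.
have [M hM] := bh.
have fM r : `|f r| <= M * M by rewrite normrM ler_pM.
have fZ z : f (\row_j Z j z) = h (Z ord0 z) * h (Z ord_max z) by rewrite /f !mxE.
have iZ : Q.-integrable setT (EFin \o (f \o (fun z => \row_j Z j z))).
  apply: (@bounded_integrable _ _ _ _ _ (M * M)) => [|z]; last exact: fM.
  rewrite (_ : _ \o _ = fun z => h (Z ord0 z) * h (Z ord_max z)); last first.
    by apply/funext => z; exact: fZ.
  case: bmh => mh _; apply: measurable_funM.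
    exact: (measurableT_comp mh (@measurable_funPT _ _ _ _ (Z ord0))).
  exact: (measurableT_comp mh (@measurable_funPT _ _ _ _ (Z ord_max))).
have := cvg_in_distribution_Rintegral cZ cf (ex_intro _ _ fM) iZ.
under [X in _ --> X]eq_Rintegral do rewrite fZ.
rewrite (Rintegral_iid_std_normal_prod Zg bmh) => /cvgrPdist_le/(_ _ e0) H.
have H1 : \forall n \near \oo, (1 < n)%N by exact: nbhs_infty_gt.
apply: filterS2 H H1 => n H n1 i j ij.
rewrite distrC; apply: le_trans H; rewrite le_eqVlt; apply/orP; left; apply/eqP.
congr (`|_ - _|); pose i0 := Ordinal (ltnW n1); pose i1 := Ordinal n1.
have i01 : i0 != i1 by [].
have bp (k l : 'I_n) : bounded_measurable (fun v => h (X k v) * h (X l v)).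
  by apply: bounded_measurableM; exact: bounded_measurable_scaled_coord.
transitivity (\int[mu n]_v (h (X i0 v) * h (X i1 v))).
  have [s [<- <-]] := exists_perm2 i01 ij.
  rewrite -[RHS](@Rintegral_col_perm _ _ _ s (fun v => h (X i0 v) * h (X i1 v))
    (@u_exchangeable n) (bp i0 i1).1).
  by apply: eq_Rintegral => v _; rewrite !scaled_coord_col_perm.
rewrite Rintegral_distribution//.
apply: eq_Rintegral => w _; rewrite /f !mxE /= (coordinate_lt _ (ltnW n1)).
by rewrite (coordinate_lt _ n1).
Qed.

End law_of_random_vector.

Theorem proposition25 (R : realType)
  (d : nat -> measure_display) (T : forall n, measurableType (d n))
  (P : forall n, probability (T n) R)
  (u : forall n, {RV (P n) >-> 'rV[R]_n})
  (u_unit : forall n, (0 < n)%N -> {ae P n, forall w, l2norm (u n w) = 1})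
  (u_exchangeable : forall n (s : 'S_n),
     equal_in_law (P n) (fun w => col_perm s (u n w)) (u n))
  (u_normal : forall k (i : 'I_k -> nat), injective i ->
     exists (d' : measure_display) (S : measurableType d')
       (Q : probability S R) (Z : 'I_k -> {RV Q >-> R}),
       iid_std_normal Z /\
       cvg_in_distribution P
         (fun n w => \row_(j < k) (Num.sqrt n%:R * coordinate (u n w) (i j)))
         Q (fun z => \row_(j < k) Z j z))
  (u_symmetric : forall n (e : 'I_n -> bool),
     equal_in_law (P n) (fun w => flip_signs e (u n w)) (u n))
  (a : forall n, 'rV[R]_n)
  (a_unit : forall n, (0 < n)%N -> l2norm (a n) = 1) :
  cvg_in_distribution P
    (fun n w => Num.sqrt n%:R * dotprod (a n) (u n w))
    (normal_prob (0 : R) 1) idfun.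
Proof.
move=> f cf [M fM].
pose mu n : probability 'rV[R]_n R := distribution (P n) (u n).
have ex n : exchangeable (mu n) by apply: distribution_exchangeable => s; exact: u_exchangeable.
have ss n : sign_symmetric (mu n).
  by apply: distribution_sign_symmetric => e; exact: u_symmetric.
have mu1 n : (0 < n)%N -> {ae mu n, forall v, l2norm v = 1}.
  by move=> n0; apply: distribution_unit; exact: u_unit.
pose b n (j : 'I_n) : R := a n ord0 j.
have b1 n : (0 < n)%N -> \sum_j b n j ^+ 2 = 1.
  move=> n0; have := a_unit n n0; rewrite /l2norm => /(congr1 (fun x => x ^+ 2)).
  rewrite expr1n sqr_sqrtr; last by apply: sumr_ge0 => i _; rewrite -expr2 sqr_ge0.
  by move=> <-; apply: eq_bigr => j _; rewrite expr2.
have bf : bounded_measurable f by split; [exact: continuous_measurable_fun|exists M].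
have linE n (v : 'rV[R]_n) : Num.sqrt n%:R * dotprod (a n) v = lin_comb b v.
  by rewrite mulr_sumr; apply: eq_bigr => j _; rewrite mulrCA.
have := cvg_test_continuous ex ss mu1 (cvg_single_coordinate ex u_normal)
  (cvg_pair_coordinates ex u_normal) b1 cf fM.
rewrite /cvg_test => H; rewrite unlock.
have ig : (normal_prob (0 : R) 1).-integrable setT (EFin \o f).
  exact: (bounded_measurable_integrable (normal_prob 0 1) bf).
rewrite -[X in _ --> X](fineK (integrable_fin_num measurableT ig)).
have blin n := bounded_measurable_lin_comb b n bf.
(* Passage to the law of u on R^n; as f is bounded, the integral is finite and the equality lifts to
   extended reals. *)
have EP n : (\int[P n]_w ((f \o (fun w => Num.sqrt n%:R * dotprod (a n) (u n w))) w)%:E)%E =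
    (\int[mu n]_v f (lin_comb b v))%:E.
  rewrite Rintegral_distribution; last exact: blin.
  rewrite fineK; first by apply: eq_integral => w _; rewrite /= linE.
  apply: integrable_fin_num => //.
  have [mF _] := blin n.
  apply: (@bounded_integrable _ _ _ (P n) (fun w => f (lin_comb b (u n w))) M) => //.
  exact: (measurableT_comp mF (@measurable_funPT _ _ _ _ (u n))).
under eq_fun do rewrite EP.
by apply: cvg_EFin; [exact: nearW|exact: H].
Qed.
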